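(* For each $N\in\{1,2,3,4\}$, let $T=C_2\times C_{2N}$. Then there are infinitely many good elliptic curves $E$ over $\mathbb{Q}$ such that $E(\mathbb{Q})_{\mathrm{tors}}\cong T$.
   Context: $C_m$ denotes the cyclic group of order $m$. For an elliptic curve $E$ over $\mathbb{Q}$, let $N_E$ be its conductor and let $c_4,c_6$ be the invariants associated to a global minimal Weierstrass model of $E$. $E$ is called good if $N_E^{6}<\max\{|c_4^3|,c_6^2\}$. *)

(* Defs.v *)
From HB Require Import structures.
From mathcomp Require Import all_boot all_order all_fingroup all_algebra all_field.
From mathcomp Require Import boolp classical_sets.

Set Implicit Arguments.
Unset Strict Implicit.
Unset Printing Implicit Defensive.

Import Order.TTheory GRing.Theory Num.Theory.

Local Open Scope ring_scope.

(* y^2 + a1 x y + a3 y = x^3 + a2 x^2 + a4 x + a6 *)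
Record wcurve (R : Type) : Type :=
  WCurve { a1 : R; a2 : R; a3 : R; a4 : R; a6 : R }.

Definition map_wcurve (R S : Type) (f : R -> S) (W : wcurve R) : wcurve S :=
  WCurve (f (a1 W)) (f (a2 W)) (f (a3 W)) (f (a4 W)) (f (a6 W)).

Definition base_change (R : nzRingType) (W : wcurve int) : wcurve R :=
  map_wcurve (fun z : int => z%:~R) W.

Section Invariants.
Variables (R : comNzRingType) (W : wcurve R).

Definition b2 : R := a1 W ^+ 2 + 4%:R * a2 W.
Definition b4 : R := 2%:R * a4 W + a1 W * a3 W.
Definition b6 : R := a3 W ^+ 2 + 4%:R * a6 W.
Definition b8 : R :=
  a1 W ^+ 2 * a6 W + 4%:R * a2 W * a6 W - a1 W * a3 W * a4 W
  + a2 W * a3 W ^+ 2 - a4 W ^+ 2.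
Definition c4 : R := b2 ^+ 2 - 24%:R * b4.
Definition c6 : R := - b2 ^+ 3 + 36%:R * b2 * b4 - 216%:R * b6.
Definition disc : R :=
  - b2 ^+ 2 * b8 - 8%:R * b4 ^+ 3 - 27%:R * b6 ^+ 2 + 9%:R * b2 * b4 * b6.

Definition elliptic : bool := disc != 0.

End Invariants.

(* W' is obtained from W by x = u^2 x' + r, y = u^3 y' + u^2 s x' + t; these
   are exactly the F-isomorphisms between curves in Weierstrass form. *)
Definition wiso (F : fieldType) (W W' : wcurve F) : Prop :=
  exists u r s t : F,
    [/\ u != 0,
        [/\ u * a1 W' = a1 W + 2%:R * s,
            u ^+ 2 * a2 W' = a2 W - s * a1 W + 3%:R * r - s ^+ 2
          & u ^+ 3 * a3 W' = a3 W + r * a1 W + 2%:R * t],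
        u ^+ 4 * a4 W' = a4 W - s * a3 W + 2%:R * r * a2 W
                         - (t + r * s) * a1 W + 3%:R * r ^+ 2 - 2%:R * s * t
      & u ^+ 6 * a6 W' = a6 W + r * a4 W + r ^+ 2 * a2 W + r ^+ 3
                         - t * a3 W - t ^+ 2 - r * t * a1 W].

Section GroupLaw.
Variables (F : fieldType) (W : wcurve F).

(* [None] is the point at infinity. *)
Definition point : eqType := option (F * F)%type.

Definition on_curve (P : point) : bool :=
  if P is Some (x, y) then
    y ^+ 2 + a1 W * x * y + a3 W * y
      == x ^+ 3 + a2 W * x ^+ 2 + a4 W * x + a6 W
  else true.

(* Chord-tangent law; the formulas are meaningful only on the curve, where
   x1 = x2 and P2 != - P1 force P1 = P2, so that the slope is the tangent's. *)
Definition padd (P1 P2 : point) : point :=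
  match P1, P2 with
  | None, _ => P2
  | _, None => P1
  | Some (x1, y1), Some (x2, y2) =>
    if (x1 == x2) && (y2 == - y1 - a1 W * x1 - a3 W) then None
    else
      let lam :=
        if x1 == x2 then
          (3%:R * x1 ^+ 2 + 2%:R * a2 W * x1 + a4 W - a1 W * y1)
            / (2%:R * y1 + a1 W * x1 + a3 W)
        else (y2 - y1) / (x2 - x1) in
      let x3 := lam ^+ 2 + a1 W * lam - a2 W - x1 - x2 in
      Some (x3, - (lam * (x3 - x1) + y1) - a1 W * x3 - a3 W)
  end.

Definition pmul (n : nat) (P : point) : point := iter n (padd P) None.

Definition torsion_points : set point :=
  [set P | on_curve P /\ exists n : nat, (0 < n)%N /\ pmul n P = None].

Definition points_of_exponent (n : nat) : set point :=
  [set P | on_curve P /\ pmul n P = None].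

(* phi is an isomorphism from A onto the subgroup S of the group of points. *)
Definition group_iso_onto (A : zmodType) (S : set point) (phi : A -> point) :
    Prop :=
  [/\ injective phi,
      (forall s t : A, phi (s + t) = padd (phi s) (phi t))
    & range phi = S].

End GroupLaw.

Definition torsion_isog (A : zmodType) (E : wcurve rat) : Prop :=
  exists phi : A -> point rat, group_iso_onto E (torsion_points E) phi.

Definition p_integral (p : nat) (W : wcurve rat) : bool :=
  all (fun a : rat => ~~ (p %| `|denq a|)%N)
      [:: a1 W; a2 W; a3 W; a4 W; a6 W].

(* Minimality is imposed at every prime p, among all p-integral models; the
   discriminant of such a model has nonnegative p-adic valuation, which is
   that of its numerator. *)
Definition global_minimal_model (E : wcurve rat) (W : wcurve int) : Prop :=
  wiso E (base_change rat W) /\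
  forall (p : nat) (W' : wcurve rat),
    prime p -> p_integral p W' -> wiso E W' ->
    (logn p `|disc W| <= logn p `|numq (disc W')|)%N.

Section Reduction.
Variables (W : wcurve int) (p : nat).

Definition reduction : wcurve 'F_p := base_change 'F_p W.

Definition good_reduction : bool := elliptic reduction.

(* (x, y) is a singular point, and the slopes T of the tangent lines there
   (translating to the origin, the quadratic part of the equation is
   Y^2 + a1 X Y - (3 x + a2) X^2) are distinct. A singular Weierstrass curve
   over 'F_p has a unique singular point, which is 'F_p-rational. *)
Definition node (x y : 'F_p) : Prop :=
  let: Wp := reduction in
  [/\ on_curve Wp (Some (x, y)),
      a1 Wp * y = 3%:R * x ^+ 2 + 2%:R * a2 Wp * x + a4 Wp,
      2%:R * y + a1 Wp * x + a3 Wp = 0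
    & separable_poly ('X^2 + a1 Wp *: 'X - (3%:R * x + a2 Wp)%:P)].

Definition multiplicative_reduction : Prop := exists x y : 'F_p, node x y.

End Reduction.

Section Ramification.
Variables (L : splittingFieldType rat) (v : L -> int).

(* v is the normalized discrete valuation attached to a prime of L above p;
   its value at 0 is irrelevant. *)
Definition normalized_valuation (p : nat) : Prop :=
  [/\ (forall x y : L, x != 0 -> y != 0 -> v (x * y) = v x + v y),
      (forall x y : L, x != 0 -> y != 0 -> x + y != 0 ->
         Num.min (v x) (v y) <= v (x + y)),
      (exists2 x : L, x != 0 & v x = 1)
    & 0 < v p%:R].

(* Ramification groups in the lower numbering. For s in the group of index 0
   the condition makes s preserve the valuation ring, so these are the
   ramification groups of the decomposition group of v. *)
Definition ram_group (i : nat) : {set gal_of {: L}} :=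
  [set s : gal_of {: L} | `[< forall x : L, x != 0 -> 0 <= v x -> s x != x ->
                 i.+1%:Z <= v (s x - x) >]].

End Ramification.

Definition gal_point (L : splittingFieldType rat) (s : gal_of {: L})
    (P : point L) : point L :=
  omap (fun xy : L * L => (s xy.1, s xy.2)) P.

(* L = Q(W[l]), and phi is a choice of 'F_l-basis of W[l]. *)
Definition division_field (W : wcurve int) (l : nat)
    (L : splittingFieldType rat) (phi : 'rV['F_l]_2 -> point L) : Prop :=
  group_iso_onto (base_change L W)
    (points_of_exponent (base_change L W) l) phi /\
  forall K : {subfield L},
    (forall (w : 'rV['F_l]_2) (x y : L),
       phi w = Some (x, y) -> x \in K /\ y \in K) ->
    (K : {vspace L}) = fullv.

(* The dimension over 'F_l of W[l] / W[l]^G. *)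
Definition codim_fixed (l : nat) (L : splittingFieldType rat)
    (phi : 'rV['F_l]_2 -> point L) (G : {set gal_of {: L}}) : nat :=
  (2 - logn l #|[set w : 'rV['F_l]_2 |
                 [forall s in G, gal_point s (phi w) == phi w]]|)%N.

(* delta_p = sum_(i >= 1) #|G_i| / #|G_0| * dim (W[l] / W[l]^(G_i)) for any
   prime l != p, where the G_i are the ramification groups of Q(W[l]) at a
   prime above p. The sum is finite as G_i is trivial for large i; its value
   is a natural number, independent of l and of the prime above p. *)
Definition is_wild_exponent (W : wcurve int) (p d : nat) : Prop :=
  exists (l : nat) (L : splittingFieldType rat)
         (phi : 'rV['F_l]_2 -> point L) (v : L -> int) (m : nat),
    let G := ram_group v in
    [/\ prime l /\ l != p,
        division_field W phi,
        normalized_valuation v p,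
        (forall i : nat, (m <= i)%N -> G i = [set 1%g])
      & d%:R = \sum_(1 <= i < m)
                 (#|G i|%:R / #|G 0%N|%:R) * (codim_fixed phi (G i))%:R :> rat].

Definition wild_exponent (W : wcurve int) (p : nat) : nat :=
  xget 0%N [set d | is_wild_exponent W p d].

(* For W a global minimal model. *)
Definition conductor_exponent (W : wcurve int) (p : nat) : nat :=
  (if good_reduction W p then 0
   else if `[< multiplicative_reduction W p >] then 1
   else 2 + wild_exponent W p)%N.

Definition conductor (W : wcurve int) : nat :=
  (\prod_(p <- primes `|disc W|) p ^ conductor_exponent W p)%N.

Definition good_curve (E : wcurve rat) : Prop :=
  exists W : wcurve int,
    global_minimal_model E W /\
    (conductor W)%:Z ^+ 6 < Num.max `|c4 W ^+ 3| (c6 W ^+ 2).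

(* Main.v *)
From HB Require Import structures.
From mathcomp Require Import all_boot all_order all_algebra all_field ring zify.
From mathcomp Require Import boolp classical_sets.
Require Import Defs.

Set Implicit Arguments.
Unset Strict Implicit.
Unset Printing Implicit Defensive.

Import Order.TTheory GRing.Theory Num.Theory.

Local Open Scope ring_scope.

(* Let q = 32^(31^(k+1)), so that 31^(k+2) divides q - 1, and consider the Frey
   curve y^2 = x (x + A) (x + B) for
     N = 1: A = 1, B = q;                 N = 2: A = 1, B = q^2;
     N = 3: A = 1 + 2 q, B = q^3 (q + 2);  N = 4: A = (1 - q^2)^4, B = 16 q^4.
   As A = 1 mod 4, 16 | B and (A, B) = 1, it is semistable, with conductor
   rad(A B (A - B)) and c4 = A^2 - A B + B^2 on its minimal model. Since
   rad(q) = 2 and rad(q - 1) <= (q - 1) / 31^(k+1), the square of the conductor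
   is smaller than c4; this is goodness. Coprimality of c4 and the discriminant
   also shows that c4 is an isomorphism invariant, and c4 separates the curves.
   The point (0, 0) is N times an explicit rational point, whence a subgroup
   C_2 x C_2N. It is the whole torsion group: for p = 3, 5, 7, 13 respectively
   there is good reduction with exactly 4 N points over F_p, and the kernel of
   reduction is torsion free, because z = x / y is additive on points with
   p^k | z up to p^(3k). *)

(** * The group law on a smooth Weierstrass curve *)

(** Goodness is a matter of a constant factor. In each family [A], [B] and [A - B] split, up to
    constants, into powers of a few polynomials in q, and the product of these polynomials without q
    itself has the degree of the larger of [A] and [B], namely 1, 2, 4 and 8. As the factor q costs
    only 2, the square of the conductor is at most of the order of magnitude of c4, and saving a
    fixed factor decides: the leading coefficient to beat is at most 4, and the saving of 31 on q -
    1 suffices for every k. The base 32 serves several ends at once: it is a power of 2, it is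
    divisible by 16, and 32 - 1 is a prime whose exponent in q - 1 grows with each 31st power.
    Taking 31st powers moreover fixes q modulo 3 and 7 and q^2 modulo 5 and 13, so one prime for
    each N bounds the torsion for all k. Finally c4 < q^31, while q^31 is the next parameter, so
    distinct parameters give distinct c4. *)

Section Collinear.
Variables (F : fieldType) (W : wcurve F).
Implicit Types P Q S T U V : (F * F)%type.

Definition neg_affine P : F * F := (P.1, - P.2 - a1 W * P.1 - a3 W).

Definition pneg (P : point F) : point F := omap neg_affine P.

Definition on_line (l m : F) P := P.2 = l * P.1 + m.

(* Vieta's formulas for the intersection of the curve with y = l x + m, so that
   tangencies need no separate treatment. *)
Definition line_section (l m : F) P Q T : Prop :=
  [/\ [/\ on_line l m P, on_line l m Q & on_line l m T],
      P.1 + Q.1 + T.1 = l ^+ 2 + a1 W * l - a2 W,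
      P.1 * Q.1 + P.1 * T.1 + Q.1 * T.1
        = a4 W - 2%:R * l * m - a1 W * m - a3 W * l
    & P.1 * Q.1 * T.1 = m ^+ 2 + a3 W * m - a6 W].

Lemma line_sectionC l m P Q T :
  line_section l m P Q T -> line_section l m Q P T.
Proof.
by case=> -[? ? ?] e1 e2 e3; split=> //; rewrite -?e1 -?e2 -?e3; ring.
Qed.

Lemma line_sectionCr l m P Q T :
  line_section l m P Q T -> line_section l m P T Q.
Proof.
by case=> -[? ? ?] e1 e2 e3; split=> //; rewrite -?e1 -?e2 -?e3; ring.
Qed.

Lemma line_section_neg l m P Q T :
  line_section l m P Q T ->
  line_section (- l - a1 W) (- m - a3 W)
    (neg_affine P) (neg_affine Q) (neg_affine T).
Proof.
rewrite /line_section /on_line /neg_affine /=.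
case=> -[-> -> ->] e1 e2 e3; split; rewrite ?e1 ?e2 ?e3; try ring.
by split; ring.
Qed.

Lemma neg_affineK : involutive neg_affine.
Proof. by case=> x y; rewrite /neg_affine /=; congr pair; ring. Qed.

Lemma pnegK : involutive pneg.
Proof. by case=> [P|] //=; rewrite neg_affineK. Qed.

Lemma on_curve_pneg (P : point F) : on_curve W (pneg P) = on_curve W P.
Proof.
case: P => [[x y]|] //=; apply/eqP/eqP => <-; ring.
Qed.

(** Substituting the line turns the equation of the curve into (x - x1)(x - x2)(x - x3) = 0, which
    holds at P. *)
Lemma line_section_on_curve l m P Q T :
  line_section l m P Q T -> on_curve W (Some P).
Proof.
case: P Q T => x1 y1 [x2 y2] [x3 y3]; rewrite /line_section /on_line /=.
case=> -[-> _ _] e1 e2 e3; apply/eqP.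
have -> : a2 W = l ^+ 2 + a1 W * l - (x1 + x2 + x3) by rewrite e1; ring.
have -> : a4 W = (x1 * x2 + x1 * x3 + x2 * x3) + 2%:R * l * m + a1 W * m
                 + a3 W * l by rewrite e2; ring.
have -> : a6 W = m ^+ 2 + a3 W * m - x1 * x2 * x3 by rewrite e3; ring.
ring.
Qed.

Lemma on_curve_same_abscissa x y1 y2 :
  on_curve W (Some (x, y1)) -> on_curve W (Some (x, y2)) ->
  y2 = y1 \/ (x, y2) = neg_affine (x, y1).
Proof.
move=> /= /eqP h1 /eqP h2.
have /eqP : (y2 - y1) * (y2 + y1 + a1 W * x + a3 W) = 0.
  have -> : (y2 - y1) * (y2 + y1 + a1 W * x + a3 W) =
    (y2 ^+ 2 + a1 W * x * y2 + a3 W * y2) - (y1 ^+ 2 + a1 W * x * y1 + a3 W *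
      y1)
    by ring.
  by rewrite h1 h2 subrr.
rewrite mulf_eq0 => /orP[/eqP/subr0_eq|/eqP h]; [by left|right].
by congr pair; rewrite -[LHS]subr0 -h /=; ring.
Qed.

Lemma line_section_exists P Q :
  on_curve W (Some P) -> on_curve W (Some Q) -> Q <> neg_affine P ->
  exists l m T, line_section l m P Q T.
Proof.
case: P Q => x1 y1 [x2 y2] cP cQ nPQ.
case: (eqVneq x1 x2) => [ex|nx].
  rewrite -{x2}ex in cQ nPQ *.
  case: (on_curve_same_abscissa cP cQ) => // ey; rewrite {y2}ey in cQ nPQ *.
  have nd : 2%:R * y1 + a1 W * x1 + a3 W != 0.
    apply/eqP => h; apply: nPQ; congr pair.
    by rewrite -[LHS]subr0 -h /=; ring.
  set l := (3%:R * x1 ^+ 2 + 2%:R * a2 W * x1 + a4 W - a1 W * y1)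
            / (2%:R * y1 + a1 W * x1 + a3 W).
  set x3 := l ^+ 2 + a1 W * l - a2 W - x1 - x1.
  have hl : a4 W = l * (2%:R * y1 + a1 W * x1 + a3 W) -
       (3%:R * x1 ^+ 2 + 2%:R * a2 W * x1 - a1 W * y1) by rewrite /l; field.
  have h6 : a6 W = y1 ^+ 2 + a1 W * x1 * y1 + a3 W * y1
      - (x1 ^+ 3 + a2 W * x1 ^+ 2 + a4 W * x1) by rewrite (eqP cP); ring.
  exists l, (y1 - l * x1), (x3, l * (x3 - x1) + y1).
  split; rewrite /on_line /=; first by split; ring.
  - by rewrite /x3; ring.
  - by rewrite /x3 hl; ring.
  - by rewrite /x3 h6 hl; ring.
have nd : x2 - x1 != 0 by rewrite subr_eq0 eq_sym.
set l := (y2 - y1) / (x2 - x1).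
set x3 := l ^+ 2 + a1 W * l - a2 W - x1 - x2.
have ey : y2 = y1 + l * (x2 - x1) by rewrite /l; field.
have h6 : a6 W = y1 ^+ 2 + a1 W * x1 * y1 + a3 W * y1
      - (x1 ^+ 3 + a2 W * x1 ^+ 2 + a4 W * x1) by rewrite (eqP cP); ring.
(* The difference of the equations of P and Q, divided by [x2 - x1], is linear in [a4]. *)
have h4 : a4 W = l * (y1 + y2) + a1 W * (l * x2 + y1) + a3 W * l
   - (x1 ^+ 2 + x1 * x2 + x2 ^+ 2 + a2 W * (x1 + x2)).
  apply: (mulIf nd).
  have -> : a4 W * (x2 - x1) = (x2 ^+ 3 + a2 W * x2 ^+ 2 + a4 W * x2 + a6 W)
    - (x1 ^+ 3 + a2 W * x1 ^+ 2 + a4 W * x1 + a6 W)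
    - (x2 - x1) * (x1 ^+ 2 + x1 * x2 + x2 ^+ 2 + a2 W * (x1 + x2)) by ring.
  by rewrite -(eqP cQ) -(eqP cP) ey; ring.
exists l, (y1 - l * x1), (x3, l * (x3 - x1) + y1).
split; rewrite /on_line /=; first by split; rewrite ?ey; ring.
- by rewrite /x3; ring.
- by rewrite /x3 h4 ey; ring.
- by rewrite /x3 h6 h4 ey; ring.
Qed.

(* The key step of associativity: when the two lines through Q differ, the
   third point on the line through -T and S is also on the line through P and
   -V, and the slopes of these lines are polynomial up to 1 / (l2 - l1). *)
Lemma line_section_assoc l1 m1 l2 m2 P Q S T V :
  line_section l1 m1 P Q T -> line_section l2 m2 Q S V -> l1 != l2 ->
  exists U, (exists l m, line_section l m (neg_affine T) S U) /\
            (exists l m, line_section l m P (neg_affine V) U).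
Proof.
case: P Q S T V => xp yp [x y] [xs ys] [xt yt] [xv yv].
rewrite /line_section /on_line /neg_affine /=.
case: W => /= A1 A2 A3 A4 A6.
case=> -[-> ey ->] e1 e2 e3 [[ey' -> ->] f1 f2 f3] nl.
have nm : l2 - l1 != 0 by rewrite subr_eq0 eq_sym.
move: e1 e2 e3 f1 f2 f3 nm {nl}.
(* Abscissas are taken relative to Q. Vieta then determines the curve: [A2], [A4], [A6] come from
   the first line, [A1] and [A3] from comparison with the second, with the difference [m] of the
   slopes as only denominator. What remains are identities of rational functions. *)
have -> : xp = x + (xp - x) by ring. set p := xp - x.
have -> : xt = x + (xt - x) by ring. set t := xt - x.
have -> : xs = x + (xs - x) by ring. set s := xs - x.
have -> : xv = x + (xv - x) by ring. set v := xv - x.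
have -> : l2 = l1 + (l2 - l1) by ring. set m := l2 - l1.
have -> : m1 = y - l1 * x by rewrite ey; ring.
have -> : m2 = y - (l1 + m) * x by rewrite ey' /m; ring.
move: p t s v m {ey ey'} => p t s v m; move: l1 => l.
move=> /= e1 e2 e3 f1 f2 f3 nm0.
have nm : m != 0 by have <- : l + m - l = m by ring.
have {}e1 : A2 = l ^+ 2 + A1 * l - (3%:R * x + p + t).
  by apply/(subr0_eq); rewrite -[RHS](subrr (l ^+ 2 + A1 * l - A2)) -{1}e1;
    ring.
have E1 : A1 = (s + v - p - t - m ^+ 2) / m - 2%:R * l.
  apply: (mulIf nm); move: f1; rewrite e1 => f1.
  apply/(subr0_eq); rewrite -[RHS](subrr ((l + m) ^+ 2 + A1 * (l + m) -
     (l ^+ 2 + A1 * l - (3%:R * x + p + t)))) -{2}f1; field.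
  exact: nm.
have E4 : A4 = ((x + p) * x + (x + p) * (x + t) + x * (x + t)) +
    (2%:R * l * (y - l * x) + A1 * (y - l * x) + A3 * l) by rewrite e2; ring.
have E3 : A3 = (p * t - s * v) / m - 2%:R * y - A1 * x.
  apply: (mulIf nm); move: f2; rewrite E4 => f2.
  apply/(subr0_eq); rewrite -[RHS](subrr (x * (x + s) + x * (x + v) + (x + s)
    * (x + v))) {2}f2 E1; field.
  exact: nm.
have E6 : A6 = (y - l * x) ^+ 2 + A3 * (y - l * x) - (x + p) * x * (x + t).
  by rewrite e3; ring.
pose k1 := l + (m ^+ 2 + t - v) / m.
pose k2 := l + (t - v) / m.
pose xu := k1 ^+ 2 + A1 * k1 - A2 - (x + t) - (x + s).
exists (xu, k1 * (xu - (x + s)) + (l + m) * s + y); split.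
  exists k1, (y + (l + m) * s - k1 * (x + s)).
  by split; [split|..]; rewrite /xu ?E6 ?E4 ?E3 ?e1 ?E1 /k1 /=; field.
exists k2, (y + l * p - k2 * (x + p)).
by split; [split|..]; rewrite /xu ?E6 ?E4 ?E3 ?e1 ?E1 /k1 /k2 /=; field.
Qed.

(** Singular points are excluded over [F] only, since the group law never leaves the rational
    points. *)
Definition smooth : Prop := forall x y, on_curve W (Some (x, y)) ->
  2%:R * y + a1 W * x + a3 W = 0 ->
  3%:R * x ^+ 2 + 2%:R * a2 W * x + a4 W - a1 W * y != 0.

Hypothesis smoothW : smooth.

(** If P and Q have the same abscissa they coincide, being on the line. Vieta then says that the
    numerator of the tangent slope is l times its denominator; a zero denominator would make both
    partial derivatives vanish at P, against smoothness. *)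
Lemma padd_line_section l m P Q T : line_section l m P Q T ->
  padd W (Some P) (Some Q) = pneg (Some T).
Proof.
move=> sPQT; have := line_section_on_curve sPQT.
case: P Q T sPQT => x1 y1 [x2 y2] [x3 y3].
rewrite /line_section /on_line /=.
case=> -[ey1 ey2 ey3] e1 e2 e3 cP.
case: (eqVneq x1 x2) => [ex|nx] /=.
  rewrite -{x2}ex in e1 e2 e3 ey2 *.
  have tangent : 3%:R * x1 ^+ 2 + 2%:R * a2 W * x1 + a4 W - a1 W * y1 =
     l * (2%:R * y1 + a1 W * x1 + a3 W).
    have -> : a4 W = x1 * x1 + x1 * x3 + x1 * x3 + 2%:R * l * m + a1 W * m
                     + a3 W * l by rewrite e2; ring.
    have -> : x3 = l ^+ 2 + a1 W * l - a2 W - x1 - x1 by rewrite -e1; ring.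
    by rewrite ey1; ring.
  rewrite [in y2 == _]ey2 -ey1; case: eqP => [hy|ny].
    have sing : 2%:R * y1 + a1 W * x1 + a3 W = 0
      by rewrite mulr_natl mulr2n {1}hy; ring.
    by have /negP[] := smoothW cP sing; rewrite tangent sing mulr0.
  have nd : 2%:R * y1 + a1 W * x1 + a3 W != 0.
    by apply/eqP => h; apply: ny; rewrite -[LHS]subr0 -h; ring.
  rewrite tangent mulfK //.
  have <- : x3 = l ^+ 2 + a1 W * l - a2 W - x1 - x1 by rewrite -e1; ring.
  rewrite /neg_affine /=.
  by congr (Some (_, _)); rewrite ey3 ey1; ring.
have -> : (y2 - y1) / (x2 - x1) = l.
  by rewrite ey1 ey2; field; rewrite subr_eq0 eq_sym.
have <- : x3 = l ^+ 2 + a1 W * l - a2 W - x1 - x2 by rewrite -e1; ring.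
by rewrite /neg_affine /=; congr (Some (_, _)); rewrite ey3 ey1; ring.
Qed.

Lemma padd0p (P : point F) : padd W None P = P. Proof. by []. Qed.

Lemma paddp0 (P : point F) : padd W P None = P. Proof. by case: P => [[]|]. Qed.

Lemma paddpN (P : point F) : padd W P (pneg P) = None.
Proof. by case: P => [[x y]|] //=; rewrite !eqxx. Qed.

Lemma paddNp (P : point F) : padd W (pneg P) P = None.
Proof. by rewrite -{2}[P]pnegK paddpN. Qed.

Lemma paddC (P Q : point F) : on_curve W P -> on_curve W Q ->
  padd W P Q = padd W Q P.
Proof.
case: P Q => [P|] [Q|]; rewrite ?paddp0 // => cP cQ.
have [->|/eqP nPQ] := eqVneq Q (neg_affine P).
  by rewrite (paddpN (Some P)) (paddNp (Some P)).
have [l [m [T sPQT]]] := line_section_exists cP cQ nPQ.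
by rewrite (padd_line_section sPQT) (padd_line_section (line_sectionC sPQT)).
Qed.

Lemma on_curve_padd (P Q : point F) : on_curve W P -> on_curve W Q ->
  on_curve W (padd W P Q).
Proof.
case: P Q => [P|] [Q|]; rewrite ?paddp0 // => cP cQ.
have [->|/eqP nPQ] := eqVneq Q (neg_affine P).
  by rewrite (paddpN (Some P)).
have [l [m [T sPQT]]] := line_section_exists cP cQ nPQ.
rewrite (padd_line_section sPQT) on_curve_pneg.
exact: line_section_on_curve (line_sectionC (line_sectionCr sPQT)).
Qed.

(** If P, Q, T are collinear then so are -P, -T, -Q, and P + Q = -T. *)
Lemma paddNp_cancel (P Q : point F) : on_curve W P -> on_curve W Q ->
  padd W (pneg P) (padd W P Q) = Q.
Proof.
case: P Q => [P|] [Q|]; rewrite ?paddp0 ?paddNp // => cP cQ.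
have [->|/eqP nPQ] := eqVneq Q (neg_affine P).
  by rewrite (paddpN (Some P)).
have [l [m [T sPQT]]] := line_section_exists cP cQ nPQ.
rewrite (padd_line_section sPQT).
rewrite (padd_line_section (line_section_neg (line_sectionCr sPQT))).
by rewrite /= neg_affineK.
Qed.

Lemma line_section_padd P Q : on_curve W (Some P) -> on_curve W (Some Q) ->
  Q <> neg_affine P -> exists l m T,
  line_section l m P Q T /\ padd W (Some P) (Some Q) = pneg (Some T).
Proof.
move=> cP cQ nPQ; have [l [m [T sPQT]]] := line_section_exists cP cQ nPQ.
by exists l, m, T; split=> //; apply: padd_line_section sPQT.
Qed.

Lemma paddA (P Q S : point F) :
  on_curve W P -> on_curve W Q -> on_curve W S ->
  padd W P (padd W Q S) = padd W (padd W P Q) S.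
Proof.
move=> cP cQ cS; case: P cP => [P|] cP; last by rewrite !padd0p.
case: Q cQ => [Q|] cQ; last by rewrite paddp0.
case: S cS => [S|] cS; last by rewrite !paddp0.
have [e|/eqP nPQ] := eqVneq Q (neg_affine P).
  have -> : Some P = pneg (Some Q) by rewrite e /= neg_affineK.
  by rewrite paddNp_cancel // [padd W _ (Some Q)]paddC ?on_curve_pneg // paddpN.
have [e|/eqP nQS] := eqVneq S (neg_affine Q).
  have -> : Some S = pneg (Some Q) by rewrite e.
  rewrite paddpN paddp0 [RHS]paddC ?on_curve_padd ?on_curve_pneg //.
  by rewrite [padd W (Some P) _]paddC // paddNp_cancel.
have [l1 [m1 [T [sPQT ePQ]]]] := line_section_padd cP cQ nPQ.
have [l2 [m2 [V [sQSV eQS]]]] := line_section_padd cQ cS nQS.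
have [->|/eqP nSP] := eqVneq S P.
  by rewrite [RHS]paddC ?on_curve_padd // [padd W _ (Some Q)]paddC.
have cT := line_section_on_curve (line_sectionC (line_sectionCr sPQT)).
(* If S is the third point on the line through P and Q, both sides are the point at infinity. *)
have [e|/eqP nST] := eqVneq S T.
  rewrite {S}e in cS nQS sQSV eQS nSP *.
  rewrite (padd_line_section (line_sectionCr (line_sectionC sPQT))) paddpN.
  rewrite (padd_line_section sPQT).
  by rewrite [RHS]paddC ?on_curve_pneg // paddpN.
(* Were the two lines equal, S would be one of the three intersections P, Q, T; comparing the
   symmetric functions leaves P or T, both settled above. *)
have nl : l1 != l2.
  apply/eqP => el; subst l2.
  have em : m2 = m1.
    case: sPQT sQSV => -[_ + _] _ _ _ [[+ _ _] _ _ _]; rewrite /on_line.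
    by move=> -> h; apply: (addrI (l1 * Q.1)).
  subst m2; case: sPQT sQSV => -[eP eQ eT] e1 e2 e3 [[_ eS eV] f1 f2 f3].
  have /eqP : (S.1 - P.1) * (S.1 - T.1) = 0.
    have -> : (S.1 - P.1) * (S.1 - T.1) = (P.1 * Q.1 + P.1 * T.1 + Q.1 * T.1)
      - (Q.1 * S.1 + Q.1 * V.1 + S.1 * V.1)
      - (Q.1 + S.1) * ((P.1 + Q.1 + T.1) - (Q.1 + S.1 + V.1)) by ring.
    by rewrite e1 e2 f1 f2; ring.
  rewrite mulf_eq0 => /orP[] /eqP/subr0_eq h.
    by apply: nSP; rewrite [S]surjective_pairing eS h -eP -surjective_pairing.
  by apply: nST; rewrite [S]surjective_pairing eS h -eT -surjective_pairing.
have [U [[l [m sTSU]] [l' [m' sPVU]]]] := line_section_assoc sPQT sQSV nl.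
by rewrite ePQ eQS (padd_line_section sTSU) (padd_line_section sPVU).
Qed.

End Collinear.

(** * The abelian group of points of a smooth curve *)

Record smooth_curve (F : fieldType) :=
  SmoothCurve { curve_of :> wcurve F; smooth_curveP : smooth curve_of }.

Section PointGroup.
Variables (F : fieldType) (E : smooth_curve F).

(** The curve carries its proof of smoothness, so that the group structure can be attached to this
    type without further hypotheses. *)
Record curve_point : Type :=
  CurvePoint { pval : option (F * F); pvalP : on_curve E pval }.

HB.instance Definition _ := [isSub for pval].
HB.instance Definition _ := [Choice of curve_point by <:].

Definition cp_add (P Q : curve_point) : curve_point :=
  CurvePoint (on_curve_padd (@smooth_curveP _ E) (pvalP P) (pvalP Q)).

Definition cp_opp (P : curve_point) : curve_point :=
  @CurvePoint (pneg E (pval P)) (etrans (on_curve_pneg E (pval P)) (pvalP P)).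

Definition cp_zero : curve_point := @CurvePoint None isT.

Fact cp_addA : associative cp_add.
Proof.
move=> P Q S; apply: val_inj; rewrite /=.
by apply: paddA; rewrite ?pvalP //; apply: smooth_curveP.
Qed.

Fact cp_addC : commutative cp_add.
Proof.
move=> P Q; apply: val_inj; rewrite /=.
by apply: paddC; rewrite ?pvalP //; apply: smooth_curveP.
Qed.

Fact cp_add0 : left_id cp_zero cp_add.
Proof. by move=> P; apply: val_inj. Qed.

Fact cp_addN : left_inverse cp_zero cp_opp cp_add.
Proof.
by move=> P; rewrite cp_addC; apply: val_inj; apply: paddpN.
Qed.

HB.instance Definition _ :=
  GRing.isZmodule.Build curve_point cp_addA cp_addC cp_add0 cp_addN.

Lemma pval_inj : injective pval. Proof. exact: val_inj. Qed.

Lemma pvalD P Q : pval (P + Q) = padd E (pval P) (pval Q). Proof. by []. Qed.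

Lemma pvalN P : pval (- P) = pneg E (pval P). Proof. by []. Qed.

Lemma pval0 : pval 0 = None. Proof. by []. Qed.

Lemma pvalMn P n : pval (P *+ n) = pmul E n (pval P).
Proof. by elim: n => //= n IHn; rewrite mulrS pvalD IHn. Qed.

End PointGroup.

(** * p-integrality of rational numbers *)

(* x lies in p^k Z_(p) *)
Definition pint (p k : nat) (x : rat) : bool :=
  ~~ (p %| `|denq (x / p%:R ^+ k)|)%N.

Section PIntegral.
Variables (p : nat) (p_pr : prime p).
Implicit Types (x y : rat) (n d : int).

Let p_neq0 : p%:R != 0 :> rat.
Proof. by rewrite pnatr_eq0 -lt0n prime_gt0. Qed.

Let pk_neq0 k : p%:R ^+ k != 0 :> rat.
Proof. by rewrite expf_neq0. Qed.

Lemma pintP k x :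
  reflect (exists n d, ~~ (p %| `|d|)%N /\ x = p%:R ^+ k * n%:~R / d%:~R)
          (pint p k x).
Proof.
apply: (iffP idP) => [px|[n [d [pd ->]]]].
  exists (numq (x / p%:R ^+ k)), (denq (x / p%:R ^+ k)); split=> //.
  by rewrite -mulrA divq_num_den; field; rewrite pk_neq0.
rewrite /pint; have -> : p%:R ^+ k * n%:~R / d%:~R / p%:R ^+ k =
  n%:~R / d%:~R :> rat.
  by rewrite mulrC -!mulrA mulKf.
apply: contra (pd) => /dvdn_trans; apply.
have d0 : d != 0 by apply: contraL (pd) => /eqP->; rewrite dvdn0.
set y := n%:~R / d%:~R.
have e : n * denq y = numq y * d.
  apply: (@intr_inj rat); rewrite !intrM [denq y]lock numqE -lock /y; field.
  by rewrite intr_eq0.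
have := dvdn_mull `|n| (dvdnn `|denq y|); rewrite -abszM e abszM Gauss_dvdr //.
by rewrite coprime_sym coprime_num_den.
Qed.

Lemma pint_int n : pint p 0 n%:~R.
Proof. by apply/pintP; exists n, 1;
  rewrite expr0 mul1r divr1 absz1 dvdn1 neq_ltn prime_gt1 ?orbT. Qed.

Lemma pint_nat m : pint p 0 m%:R.
Proof. exact: (pint_int m). Qed.

Lemma pint0 k : pint p k 0.
Proof.
apply/pintP; exists 0, 1.
by rewrite mulr0 mul0r absz1 dvdn1 neq_ltn prime_gt1 ?orbT.
Qed.

Lemma pintD k x y : pint p k x -> pint p k y -> pint p k (x + y).
Proof.
move=> /pintP[n [d [pd ->]]] /pintP[n' [d' [pd' ->]]]; apply/pintP.
exists (n * d' + n' * d), (d * d').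
rewrite abszM Euclid_dvdM // negb_or pd pd'; split=> //.
have d0 : d != 0 by apply: contraL (pd) => /eqP->; rewrite dvdn0.
have d0' : d' != 0 by apply: contraL (pd') => /eqP->; rewrite dvdn0.
by rewrite intrD !intrM; field; rewrite !intr_eq0 d0 d0'.
Qed.

Lemma pintM k l x y : pint p k x -> pint p l y -> pint p (k + l) (x * y).
Proof.
move=> /pintP[n [d [pd ->]]] /pintP[n' [d' [pd' ->]]]; apply/pintP.
exists (n * n'), (d * d').
rewrite abszM Euclid_dvdM // negb_or pd pd'; split=> //.
by rewrite !intrM exprD invfM; ring.
Qed.

Lemma pint_le k l x : (k <= l)%N -> pint p l x -> pint p k x.
Proof.
move=> le_kl /pintP[n [d [pd ->]]]; apply/pintP.
exists (p%:Z ^+ (l - k) * n), d; split=> //.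
by rewrite intrM rmorphXn /= -{1}(subnKC le_kl) exprD; ring.
Qed.

Lemma pintN k x : pint p k (- x) = pint p k x.
Proof. by rewrite /pint mulNr denqN. Qed.

Lemma pintB k x y : pint p k x -> pint p k y -> pint p k (x - y).
Proof. by move=> px py; rewrite pintD ?pintN. Qed.

Lemma pintM0 k x y : pint p 0 x -> pint p k y -> pint p k (x * y).
Proof. exact: pintM. Qed.

Lemma pintMr k x y : pint p k x -> pint p 0 y -> pint p k (x * y).
Proof. by rewrite mulrC => px py; apply: pintM0. Qed.

Lemma pintX k m x : pint p k x -> pint p (m * k) (x ^+ m).
Proof.
move=> px; elim: m => [|m IHm]; first by rewrite expr0 (pint_nat 1).
by rewrite exprS mulSn pintM.
Qed.

Lemma pint0X m x : pint p 0 x -> pint p 0 (x ^+ m).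
Proof. by move/(pintX m); rewrite muln0. Qed.

Lemma pintS_int k n : pint p k n%:~R = (p ^ k %| `|n|)%N.
Proof.
apply/pintP/idP => [[m [d [pd]]]|/dvdnP[m em]].
  have d0 : d != 0 by apply: contraL (pd) => /eqP->; rewrite dvdn0.
  move=> e; have : n * d = p%:Z ^+ k * m.
    apply: (@intr_inj rat); rewrite !intrM e rmorphXn /=; field.
    by rewrite intr_eq0.
  move/(congr1 absz); rewrite !abszM abszX absz_nat => e'.
  have : (p ^ k %| `|n| * `|d|)%N by rewrite e' dvdn_mulr.
  by rewrite Gauss_dvdl // coprimeXl // prime_coprime.
exists ((-1) ^+ (n < 0)%R * m%:Z), 1.
rewrite absz1 dvdn1 neq_ltn prime_gt1 // orbT divr1; split=> //.
by rewrite {1}[n]intEsign em PoszM !intrM !rmorphXn /=; ring.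
Qed.

Lemma pint_inv x : pint p 0 x -> ~~ pint p 1 x -> pint p 0 x^-1.
Proof.
move=> /pintP[n [d [pd ->]]] npx; apply/pintP.
rewrite expr0 mul1r in npx *.
exists d, n; split; last by rewrite mul1r invf_div.
apply: contra npx => /dvdnP[m em]; apply: pintMr.
  by rewrite pintS_int expn1 em dvdn_mull.
by apply/pintP; exists 1, d; rewrite expr0 mul1r mul1r.
Qed.

Lemma pint_inv1 x : ~~ pint p 0 x -> pint p 1 x^-1.
Proof.
rewrite {1}/pint expr0 divr1 negbK => pd; rewrite -[x]divq_num_den.
have pn : ~~ (p %| `|numq x|)%N.
  apply/negP => pn; have := coprime_num_den x; rewrite /coprime => /eqP e.
  have : (p %| gcdn `|numq x| `|denq x|)%N by rewrite dvdn_gcd pn.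
  by rewrite e dvdn1 => /eqP p1; move: (prime_gt1 p_pr); rewrite p1.
rewrite invf_div; apply: pintMr; first by rewrite pintS_int expn1.
by apply: pint_inv; rewrite ?pint_int // pintS_int expn1.
Qed.

Lemma pintV_unit k x y :
  pint p 0 x -> ~~ pint p 1 x -> pint p k (x * y) -> pint p k y.
Proof.
move=> px ux pxy; have x0 : x != 0 by apply: contraNneq ux => ->; apply: pint0.
by rewrite -[y](mulKf x0); apply: pintM0 => //; apply: pint_inv.
Qed.

Lemma pintVp k x : pint p k.+1 (p%:R * x) -> pint p k x.
Proof.
move=> /pintP[n [d [pd e]]]; apply/pintP; exists n, d; split=> //.
by apply: (mulfI p_neq0); rewrite e exprS; ring.
Qed.

Lemma pint_unit1 : ~~ pint p 1 1.
Proof. by rewrite (pintS_int 1 1) expn1 absz1 dvdn1 neq_ltn prime_gt1 ?orbT.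
  Qed.

(** If x were not p-integral, p would divide 1 / x and hence 1 = (1 / x)^m x^m. *)
Lemma pint_of_pow m x : (0 < m)%N -> pint p 0 (x ^+ m) -> pint p 0 x.
Proof.
move=> m0 px; case: (boolP (pint p 0 x)) => // nx; have pv := pint_inv1 nx.
have x0 : x != 0 by apply/eqP => e; rewrite e pint0 in nx.
have : pint p 1 (x^-1 ^+ m * x ^+ m).
  apply: pintMr => //; apply: pint_le (pintX m pv); by rewrite muln1.
by rewrite exprVn mulVf ?expf_neq0 // (negPf pint_unit1).
Qed.

Lemma pint_logn k x : x != 0 -> pint p k x -> (k <= logn p `|numq x|)%N.
Proof.
move=> x0 px; rewrite -pfactor_dvdn ?absz_gt0 ?numq_eq0 // -pintS_int numqE.
by apply: pintMr; rewrite ?pint_int.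
Qed.

Lemma pint_val x : x != 0 -> pint p 0 x ->
  exists k, pint p k x && ~~ pint p k.+1 x.
Proof.
move=> x0 px; have ex : exists k, pint p k x by exists 0%N.
case: (ex_maxnP ex (fun k => @pint_logn k x x0)) => k pk mk.
by exists k; rewrite pk; apply/negP => /mk; rewrite ltnn.
Qed.

End PIntegral.

(* The powers of the maximal ideal of a discrete valuation ring in F whose
   residue characteristic is an odd prime of absolute ramification index 1. *)
Record filtration (F : fieldType) := Filtration {
  filt :> nat -> F -> bool;
  filt0 k : filt k 0;
  filt1 : filt 0 1;
  filtB k x y : filt k x -> filt k y -> filt k (x - y);
  filtM k l x y : filt k x -> filt l y -> filt (k + l) (x * y);
  filt_le k l x : (k <= l)%N -> filt l x -> filt k x;
  filt_unit1 : ~~ filt 1 1;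
  filt_unit2 : ~~ filt 1 2%:R;
  filt_inv x : filt 0 x -> ~~ filt 1 x -> filt 0 x^-1;
  filt_inv1 x : ~~ filt 0 x -> filt 1 x^-1;
  filtVprime m k x : prime m -> filt k.+1 (m%:R * x) -> filt k x;
  filt_val x : x != 0 -> filt 0 x -> exists k, filt k x && ~~ filt k.+1 x }.

Section PFiltration.
Variables (p : nat) (p_pr : prime p) (p_odd : odd p).

Fact pint_unit2 : ~~ pint p 1 2%:R.
Proof.
rewrite (pintS_int p_pr 1 2) expn1 (dvdn_prime2 p_pr) //.
by apply: contraTneq p_odd => ->.
Qed.

(** Multiplication by a prime raises the p-adic valuation by at most 1: by exactly 1 for p, by 0 for
    the others. *)
Fact pintVprime m k x : prime m -> pint p k.+1 (m%:R * x) -> pint p k x.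
Proof.
move=> m_pr pmx; case: (eqVneq m p) => [emp|nmp].
  by rewrite emp in pmx; apply: pintVp pmx.
apply: (pint_le p_pr (leqnSn k)); apply: (pintV_unit p_pr) pmx.
  exact: pint_nat.
by rewrite (pintS_int p_pr 1 m) expn1 absz_nat (dvdn_prime2 p_pr) // eq_sym.
Qed.

Definition pfiltration : filtration rat :=
  @Filtration _ (pint p) (pint0 p_pr) (pint_nat p_pr 1) (@pintB _ p_pr)
    (@pintM _ p_pr) (@pint_le _ p_pr) (pint_unit1 p_pr) pint_unit2
    (@pint_inv _ p_pr) (@pint_inv1 _ p_pr) pintVprime (@pint_val _ p_pr).
End PFiltration.

Section FiltrationTheory.
Variables (F : fieldType) (I : filtration F).
Implicit Types x y : F.

Lemma filtN k x : I k x -> I k (- x).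
Proof. by move=> Ix; rewrite -[- x]add0r; apply: filtB; rewrite ?filt0. Qed.

Lemma filtD k x y : I k x -> I k y -> I k (x + y).
Proof. by move=> Ix /filtN Iy; rewrite -[y]opprK; apply: filtB. Qed.

Lemma filtM0 k x y : I 0%N x -> I k y -> I k (x * y).
Proof. exact: filtM. Qed.

Lemma filtMr k x y : I k x -> I 0%N y -> I k (x * y).
Proof. by move=> Ix Iy; rewrite mulrC; apply: filtM0. Qed.

Lemma filt_nat n : I 0%N n%:R.
Proof.
elim: n => [|n IHn]; first exact: filt0.
by rewrite -addn1 natrD; apply: filtD => //; apply: filt1.
Qed.

Lemma filtX0 n x : I 0%N x -> I 0%N (x ^+ n).
Proof.
by move=> Ix; elim: n => [|n IHn]; rewrite ?exprS ?filt1 //; apply: filtM0.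
Qed.

Lemma filtW k x : I k x -> I 0%N x.
Proof. exact: filt_le. Qed.

Lemma filtV_unit k x y :
  I 0%N x -> ~~ I 1%N x -> I k (x * y) -> I k y.
Proof.
move=> Ix ux Ixy; have x0 : x != 0 by apply: contraNneq ux => ->; apply: filt0.
by rewrite -[y](mulKf x0); apply: filtM0 => //; apply: filt_inv.
Qed.

Lemma filt_prime x y : I 0%N x -> I 1%N (x * y) -> I 1%N x \/ I 1%N y.
Proof.
move=> Ix Ixy; case: (boolP (I 1%N x)) => [|ux]; [by left|right].
exact: filtV_unit Ixy.
Qed.

Lemma filt_unitD x y : ~~ I 1%N x -> I 1%N y -> ~~ I 1%N (x + y).
Proof. by move=> ux Iy; apply: contra ux => /filtB/(_ Iy); rewrite addrK. Qed.

Lemma filt_unitM x y : I 0%N x ->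
  ~~ I 1%N x -> ~~ I 1%N y -> ~~ I 1%N (x * y).
Proof. by move=> Ix ux uy; apply/negP => /(filt_prime Ix)[]; apply/negP. Qed.

Lemma filt_sqr x : I 0%N (x ^+ 2) -> I 0%N x.
Proof.
move=> Ixx; case: (boolP (I 0%N x)) => // nx; have Iv := filt_inv1 nx.
have x0 : x != 0 by apply/eqP => e; rewrite e filt0 in nx.
have : I 1%N (x^-1 ^+ 2 * x ^+ 2).
  by apply: filtMr => //; rewrite expr2; apply: filtMr => //; apply: filtW Iv.
by rewrite exprVn mulVf ?expf_neq0 // (negPf (filt_unit1 _)).
Qed.

Lemma filt_sqr1 x : I 1%N (x ^+ 2) -> I 1%N x.
Proof.
move=> Ixx; have Ix : I 0%N x by apply: filt_sqr; apply: filtW Ixx.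
by case/(filt_prime Ix): Ixx.
Qed.

End FiltrationTheory.

(** * The kernel of reduction has no torsion *)

Section Formal.
Variables (F : fieldType) (I : filtration F) (a b : F).
Hypotheses (pa : I 0%N a) (pb : I 0%N b).
Variable E : smooth_curve F.
Hypothesis defE : curve_of E = WCurve 0 a 0 b 0.

(* The coordinates z = x / y and w = 1 / y around the point at infinity. *)
Definition zw_point (z w : F) : point F :=
  if w == 0 then None else Some (z / w, w^-1).

Definition zw_curve (z w : F) : Prop :=
  w = z ^+ 3 + a * z ^+ 2 * w + b * z * w ^+ 2.

(** The level [3 * k] reflects that w is a unit times z^3 near the point at infinity. *)
Definition formal_point k z w : Prop :=
  [/\ I k z, I (3 * k)%N w & zw_curve z w].

Lemma zw_curve_eq0 z : zw_curve z 0 -> z = 0.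
Proof.
move=> h; have /eqP : z ^+ 3 = 0 by rewrite [RHS]h; ring.
by rewrite expf_eq0 => /andP[_ /eqP].
Qed.

(** Vieta's formulas for the cubic in z obtained by substituting w = [al] z + [be] in [zw_curve];
    its leading coefficient is 1 + a [al] + b [al]^2. *)
Record zw_line al be z1 w1 z2 w2 z3 w3 : Prop := ZwLine {
  zw_line_on : [/\ w1 = al * z1 + be, w2 = al * z2 + be & w3 = al * z3 + be];
  zw_line_lead : 1 + a * al + b * al ^+ 2 != 0;
  zw_line_e1 : (1 + a * al + b * al ^+ 2) * (z1 + z2 + z3)
               = - (a * be + 2%:R * b * al * be);
  zw_line_e2 : (1 + a * al + b * al ^+ 2) * (z1 * z2 + z1 * z3 + z2 * z3)
               = b * be ^+ 2 - al;
  zw_line_e3 : (1 + a * al + b * al ^+ 2) * (z1 * z2 * z3) = be }.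

Lemma zw_line_curve al be z1 w1 z2 w2 z3 w3 :
  zw_line al be z1 w1 z2 w2 z3 w3 -> zw_curve z3 w3.
Proof.
case=> -[_ _ ->] _ e1 e2 e3; rewrite /zw_curve.
set L := 1 + _ + _ in e1 e2 e3; apply/subr0_eq.
have <- : - (L * ((z3 - z1) * (z3 - z2) * (z3 - z3))) = 0 by ring.
have -> : L * ((z3 - z1) * (z3 - z2) * (z3 - z3)) = L * z3 ^+ 3
  - L * (z1 + z2 + z3) * z3 ^+ 2 + L * (z1 * z2 + z1 * z3 + z2 * z3) * z3
  - L * (z1 * z2 * z3) by ring.
by rewrite e1 e2 e3 /L; ring.
Qed.

(** Subtracting the two equations gives (w2 - w1) D = (z2 - z1) M with D a unit, so M / D serves as
    slope for chord and tangent alike. It lies at level 2k, hence the intercept at level 3k, and the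
    sum of the three roots is a multiple of the intercept. *)
Lemma formal_line k z1 w1 z2 w2 : (0 < k)%N ->
  formal_point k z1 w1 -> formal_point k z2 w2 ->
  exists al be z3 w3, [/\ zw_line al be z1 w1 z2 w2 z3 w3,
    formal_point k z3 w3 & I (3 * k)%N (z1 + z2 + z3)].
Proof.
move=> k0 [pz1 pw1 c1] [pz2 pw2 c2].
have e3k : (3 * k = 2 * k + k)%N by rewrite mulSn addnC.
have p0z1 := filtW pz1; have p0z2 := filtW pz2.
have p0w1 := filtW pw1; have p0w2 := filtW pw2.
have p2w1 : I (2 * k)%N w1 by apply: filt_le pw1; rewrite // leq_mul2r orbT.
have pkw1 : I k w1 by apply: filt_le p2w1; rewrite // leq_pmull.
have pkw2 : I k w2 by apply: filt_le pw2; rewrite // leq_pmull.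
set D := 1 - a * z2 ^+ 2 - b * z2 * (w1 + w2).
set M := z1 ^+ 2 + z1 * z2 + z2 ^+ 2 + a * w1 * (z1 + z2) + b * w1 ^+ 2.
have eDM : (w2 - w1) * D = (z2 - z1) * M.
  apply/subr0_eq; rewrite /D /M.
  have h1 : w1 - (z1 ^+ 3 + a * z1 ^+ 2 * w1 + b * z1 * w1 ^+ 2) = 0.
    by rewrite {1}c1 subrr.
  have h2 : w2 - (z2 ^+ 3 + a * z2 ^+ 2 * w2 + b * z2 * w2 ^+ 2) = 0.
    by rewrite {1}c2 subrr.
  by rewrite -[RHS](subrr 0) -{1}h2 -h1; ring.
have uD : ~~ I 1%N D.
  have -> : D = 1 + (- (a * z2 ^+ 2 + b * z2 * (w1 + w2))) by rewrite /D; ring.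
  apply: filt_unitD; rewrite ?filt_unit1 //; apply: filtN.
  apply: (filt_le k0); apply: filtD => //.
    by apply: filtM0 => //; rewrite expr2; apply: filtM0.
  by apply: filtMr => //; [apply: filtM0|apply: filtD].
have pD : I 0%N D.
  rewrite /D -addrA; apply: filtD => //; first exact: (filt_nat _ 1).
  rewrite -opprD; apply: filtN; apply: filtD => //.
    by apply: filtM0 => //; apply: filtX0.
  by apply: filtM0 => //; [apply: filtM0|apply: filtD].
have D0 : D != 0 by apply: contraNneq uD => ->; apply: filt0.
have pM : I (2 * k)%N M.
  have pzz z z' : I k z -> I k z' -> I (2 * k)%N (z * z').
    by rewrite mul2n -addnn; apply: filtM.
  rewrite /M !expr2; do !apply: filtD => //; try exact: pzz.
    apply: filtMr => //; [exact: filtM0|exact: filtD].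
  by apply: filtM0 => //; apply: pzz.
set al := M / D.
have pal : I (2 * k)%N al by apply: filtMr => //; apply: filt_inv.
have p0al := filtW pal.
have ew : w2 = w1 + al * (z2 - z1).
  rewrite -[LHS](subrK w1) addrC; congr (_ + _); apply: (mulIf D0).
  by rewrite eDM /al; field.
set be := w1 - al * z1.
have pbe : I (3 * k)%N be.
  apply: filtB => //; rewrite {1}e3k.
  exact: filtM.
have p0be := filtW pbe.
have pkbe : I k be by apply: filt_le pbe; rewrite // leq_pmull.
set L := 1 + a * al + b * al ^+ 2.
have p1al : I 1%N al by apply: filt_le pal; rewrite // muln_gt0.
have uL : ~~ I 1%N L.
  rewrite /L -addrA; apply: filt_unitD; rewrite ?filt_unit1 //.
  apply: filtD => //; first exact: filtM0.
  by rewrite expr2; apply: filtM0 => //; apply: filtM0.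
have pL : I 0%N L.
  rewrite /L; do !apply: filtD => //; first exact: (filt_nat _ 1).
    exact: filtM0.
  by apply: filtM0 => //; apply: filtX0.
have L0 : L != 0 by apply: contraNneq uL => ->; apply: filt0.
set s := - (a * be + 2%:R * b * al * be) / L.
have ps : I (3 * k)%N s.
  apply: filtMr => //; last exact: filt_inv.
  apply: filtN; apply: filtD => //; apply: filtM0 => //.
  by do !apply: filtM0 => //; apply: (filt_nat _ 2).
have pks : I k s by apply: filt_le ps; rewrite // leq_pmull.
pose z3 := s - z1 - z2; pose w3 := al * z3 + be.
have pz3 : I k z3 by do !apply: filtB => //.
have line : zw_line al be z1 w1 z2 w2 z3 w3.
  split=> //.
  - by split; rewrite ?ew /w3 /be; ring.
  - by rewrite /z3 /s -/L; field.
  - rewrite -/L; apply/subr0_eq.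
    have eDM' : al * D - M = 0 by rewrite /al; field.
    have -> : L * (z1 * z2 + z1 * z3 + z2 * z3) =
      L * (z1 * z2) - (L * (z1 + z2) ^+ 2
         + (a * be + 2%:R * b * al * be) * (z1 + z2)) by rewrite /z3 /s; field.
    by rewrite -eDM' /L /D /M /be ew; ring.
  - rewrite -/L; apply/subr0_eq.
    have eDM' : al * D - M = 0 by rewrite /al; field.
    have h1 : w1 - (z1 ^+ 3 + a * z1 ^+ 2 * w1 + b * z1 * w1 ^+ 2) = 0.
      by rewrite {1}c1 subrr.
    have -> : L * (z1 * z2 * z3) = z1 * z2 *
      (- (a * be + 2%:R * b * al * be) - L * (z1 + z2)) by rewrite /z3 /s;
        field.
    transitivity (z1 * (al * D - M)
      - (w1 - (z1 ^+ 3 + a * z1 ^+ 2 * w1 + b * z1 * w1 ^+ 2))).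
      by rewrite /L /D /M /be ew; ring.
    by rewrite eDM' h1 mulr0 subrr.
exists al, be, z3, w3; split => //; last first.
  by have -> : z1 + z2 + z3 = s by rewrite /z3; ring.
split=> //; last exact: zw_line_curve line.
apply: filtD => //; rewrite {1}e3k.
exact: filtM.
Qed.

(** Dividing w = [al] z + [be] by w gives 1 = [al] x + [be] y. For nonzero [be] this is a line of
    slope - [al] / [be] in the (x, y)-plane; for [be] = 0 the line passes through the point at
    infinity. A point with w = 0 is at infinity itself and forces [be] = 0. *)
Lemma zw_line_padd al be z1 w1 z2 w2 z3 w3 :
  zw_line al be z1 w1 z2 w2 z3 w3 -> zw_curve z1 w1 -> zw_curve z2 w2 ->
  padd E (zw_point z1 w1) (zw_point z2 w2) = zw_point (- z3) (- w3).
Proof.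
move=> line c1 c2; have c3 := zw_line_curve line.
case: line => -[ew1 ew2 ew3]; set L := 1 + _ + _ => L0 e1 e2 e3.
rewrite /zw_point oppr_eq0.
case: (eqVneq w1 0) => [w10|w10].
  have z10 : z1 = 0 by apply: zw_curve_eq0; rewrite w10 in c1.
  have be0 : be = 0 by rewrite -e3 z10; ring.
  have ez3 : z3 = - z2.
    apply: (mulfI L0); apply/subr0_eq; move: e1; rewrite be0 z10 => e1.
    by transitivity (L * (0 + z2 + z3)); [ring|rewrite e1; ring].
  have -> : w3 = - w2 by rewrite ew3 ew2 ez3 be0; ring.
  by rewrite padd0p ez3 oppr_eq0 !opprK.
case: (eqVneq w2 0) => [w20|w20].
  have z20 : z2 = 0 by apply: zw_curve_eq0; rewrite w20 in c2.
  have be0 : be = 0 by rewrite -e3 z20; ring.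
  have ez3 : z3 = - z1.
    apply: (mulfI L0); apply/subr0_eq; move: e1; rewrite be0 z20 => e1.
    by transitivity (L * (z1 + 0 + z3)); [ring|rewrite e1; ring].
  have -> : w3 = - w1 by rewrite ew3 ew1 ez3 be0; ring.
  by rewrite paddp0 ez3 oppr_eq0 (negPf w10) !opprK.
(* A line through infinity and two finite points: the third root is 0 and the two points are
   opposite. *)
case: (eqVneq be 0) => [be0|be0].
  have z0 z w : w != 0 -> w = al * z + be -> z != 0.
    by rewrite be0 => w0 e; apply: contraNneq w0 => z0;
      rewrite e z0 mulr0 addr0.
  have /eqP : L * (z1 * z2 * z3) = 0 by rewrite e3.
  rewrite !mulf_eq0 (negPf L0) (negPf (z0 _ _ w10 ew1)) (negPf (z0 _ _ w20
    ew2)).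
  move=> /eqP z30; have -> : w3 = 0 by rewrite ew3 z30 be0; ring.
  rewrite eqxx.
  have ez2 : z2 = - z1.
    apply: (mulfI L0); apply/subr0_eq; move: e1; rewrite be0 z30 => e1.
    by transitivity (L * (z1 + z2 + 0)); [ring|rewrite e1; ring].
  have ew : w2 = - w1 by rewrite ew2 ew1 ez2 be0; ring.
  have -> : Some (z2 / w2, w2^-1) = pneg E (Some (z1 / w1, w1^-1)).
    rewrite ez2 ew /pneg /neg_affine /= defE /= invrN mulrNN.
    by congr (Some (_, _)); ring.
  exact: paddpN.
(* This product and the sums below are symmetric in the roots, so Vieta in z evaluates them; their
   quotients are the symmetric functions of the abscissas z / w. *)
have eW : w1 * w2 * w3 = be ^+ 3 / L.
  apply: (mulfI L0); rewrite ew1 ew2 ew3.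
  transitivity (al ^+ 3 * (L * (z1 * z2 * z3))
    + al ^+ 2 * be * (L * (z1 * z2 + z1 * z3 + z2 * z3))
    + al * be ^+ 2 * (L * (z1 + z2 + z3)) + L * be ^+ 3); first by ring.
  by rewrite e1 e2 e3; transitivity (be ^+ 3); [rewrite /L; ring|field].
have w30 : w3 != 0.
  apply/eqP => w30; move/eqP: eW; rewrite w30 mulr0 eq_sym mulf_eq0 invr_eq0.
  by rewrite expf_eq0 (negPf be0) (negPf L0).
rewrite (negPf w30).
suff sec : line_section E (- al / be) be^-1
    (z1 / w1, w1^-1) (z2 / w2, w2^-1) (z3 / w3, w3^-1).
  rewrite (padd_line_section (@smooth_curveP _ E) sec) /pneg /neg_affine /=
    defE /=.
  by rewrite invrN mulrNN; congr (Some (_, _)); ring.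
have eS1 : z1 * w2 * w3 + z2 * w1 * w3 + z3 * w1 * w2
  = (al ^+ 2 * be - a * be ^+ 3) / L.
  apply: (mulfI L0); rewrite ew1 ew2 ew3.
  transitivity (3%:R * al ^+ 2 * (L * (z1 * z2 * z3))
    + 2%:R * al * be * (L * (z1 * z2 + z1 * z3 + z2 * z3))
    + be ^+ 2 * (L * (z1 + z2 + z3))); first by ring.
  by rewrite e1 e2 e3; field.
have eS2 : z1 * z2 * w3 + z1 * z3 * w2 + z2 * z3 * w1
  = (2%:R * al * be + b * be ^+ 3) / L.
  apply: (mulfI L0); rewrite ew1 ew2 ew3.
  transitivity (3%:R * al * (L * (z1 * z2 * z3))
    + be * (L * (z1 * z2 + z1 * z3 + z2 * z3))); first by ring.
  by rewrite e2 e3; field.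
have eS3 : z1 * z2 * z3 = be / L by apply: (mulfI L0); rewrite e3; field.
split; rewrite ?defE /on_line /=.
- have on z w : w != 0 -> w = al * z + be -> w^-1 = - al / be * (z / w) + be^-1.
    move=> w0 ew; transitivity ((w - al * z) / be / w).
      have -> : w - al * z = be by rewrite ew; ring.
      by field; rewrite w0 be0.
    by field; rewrite w0 be0.
  by split; apply: on.
- transitivity ((z1 * w2 * w3 + z2 * w1 * w3 + z3 * w1 * w2) / (w1 * w2 * w3)).
    by field; rewrite w10 w20 w30.
  by rewrite eW eS1; field; rewrite ?L0 ?be0 ?andbT.
- transitivity ((z1 * z2 * w3 + z1 * z3 * w2 + z2 * z3 * w1) / (w1 * w2 * w3)).
    by field; rewrite w10 w20 w30.
  by rewrite eW eS2; field; rewrite ?L0 ?be0 ?andbT.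
- transitivity (z1 * z2 * z3 / (w1 * w2 * w3)).
    by field; rewrite w10 w20 w30.
  by rewrite eW eS3; field; rewrite ?L0 ?be0 ?andbT.
Qed.

(* The k-th step of the filtration of the kernel of reduction. *)
Definition in_kernel k (P : point F) : Prop :=
  exists z w, formal_point k z w /\ P = zw_point z w.

Lemma formal_add k z1 w1 z2 w2 : (0 < k)%N ->
  formal_point k z1 w1 -> formal_point k z2 w2 ->
  exists z3 w3, [/\ formal_point k z3 w3, I (3 * k)%N (z3 - (z1 + z2)) &
    padd E (zw_point z1 w1) (zw_point z2 w2) = zw_point z3 w3].
Proof.
move=> k0 f1 f2; have [al [be [z3 [w3 [line [Iz3 Iw3 c3] Is]]]]] :=
  formal_line k0 f1 f2.
exists (- z3), (- w3); split.
- split; [exact: filtN|exact: filtN|].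
  by rewrite /zw_curve {1}c3; ring.
- by have -> : - z3 - (z1 + z2) = - (z1 + z2 + z3) by [ring]; apply: filtN.
- by case: f1 f2 => _ _ c1 [_ _ c2]; apply: zw_line_padd line c1 c2.
Qed.

Lemma formal_mul k z w (P : curve_point E) n : (0 < k)%N ->
  formal_point k z w -> pval P = zw_point z w ->
  exists zn wn, [/\ formal_point k zn wn, I (3 * k)%N (zn - n%:R * z)
                  & pval (P *+ n) = zw_point zn wn].
Proof.
move=> k0 f eP; elim: n => [|n [zn [wn [fn In en]]]].
  exists 0, 0; split; [split; rewrite ?filt0 // /zw_curve; ring| |].
    by rewrite mul0r subrr filt0.
  by rewrite /zw_point eqxx.
have [z' [w' [f' I' e']]] := formal_add k0 f fn; exists z', w'; split=> //.
  have -> : z' - n.+1%:R * z = (z' - (z + zn)) + (zn - n%:R * z).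
    by rewrite -addn1 natrD; ring.
  exact: filtD.
by rewrite mulrS pvalD en eP e'.
Qed.

Lemma in_kernel_mul k (P : curve_point E) n : (0 < k)%N ->
  in_kernel k (pval P) -> in_kernel k (pval (P *+ n)).
Proof.
move=> k0 [z [w [f e]]]; have [zn [wn [fn _ en]]] := formal_mul n k0 f e.
by exists zn, wn.
Qed.

(** The equation reads w (1 - a z^2 - b z w) = z^3, and the bracket is a unit. *)
Lemma zw_unit z w : I 1%N z -> I 1%N w -> zw_curve z w ->
  exists2 u, I 0%N u & w = u * z ^+ 3.
Proof.
move=> Iz Iw c; pose D := 1 - a * z ^+ 2 - b * z * w.
have I0z := filtW Iz; have I0w := filtW Iw.
have ID : I 1%N (- (a * z ^+ 2 + b * z * w)).
  apply: filtN; apply: filtD; last by do !apply: filtM0.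
  by apply: filtM0 => //; rewrite expr2; apply: filtM0.
have eD : D = 1 + - (a * z ^+ 2 + b * z * w) by rewrite /D; ring.
have uD : ~~ I 1%N D by rewrite eD; apply: filt_unitD; rewrite ?filt_unit1.
have I0D : I 0%N D by rewrite eD; apply: filtD; rewrite ?filt1 ?(filtW ID).
have D0 : D != 0 by apply: contraNneq uD => ->; apply: filt0.
exists D^-1; first exact: filt_inv.
apply: (mulfI D0); rewrite mulVKf //; apply/subr0_eq.
transitivity (w - (z ^+ 3 + a * z ^+ 2 * w + b * z * w ^+ 2)).
  by rewrite /D; ring.
by rewrite -c subrr.
Qed.

(** Let z have exact level k + 1. If lP = 0, additivity puts l z at level 3k + 3; a prime costs at
    most one level, so z is at level 3k + 2, which is at least k + 2. *)
Lemma in_kernel_prime_torsion_free (P : curve_point E) l :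
  prime l -> in_kernel 1 (pval P) -> P *+ l = 0 -> P = 0.
Proof.
move=> l_pr [z [w [[Iz Iw c] eP]]] Pl0; apply: pval_inj; rewrite eP pval0.
case: (eqVneq z 0) => [z0|z0].
  have [u _ ->] := zw_unit Iz (filt_le (isT : 1 <= 3 * 1)%N Iw) c.
  by rewrite z0 /zw_point expr0n mulr0 eqxx.
have [[|k] /andP[Ik nIk]] := filt_val z0 (filtW Iz); first by rewrite Iz in nIk.
have f : formal_point k.+1 z w.
  split=> //; have [u Iu ->] := zw_unit Iz (filt_le (isT : 1 <= 3 * 1)%N Iw) c.
  apply: filtM0 => //; rewrite exprS expr2 mulSn; apply: filtM => //.
  by rewrite mul2n -addnn; apply: filtM.
have [zl [wl [[_ _ cl] Il el]]] := formal_mul l (ltn0Sn k) f eP.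
move: el; rewrite Pl0 pval0 /zw_point; case: eqVneq => // wl0 _.
have zl0 : zl = 0 by apply: zw_curve_eq0; rewrite wl0 in cl.
move: Il; rewrite zl0 sub0r => /filtN.
rewrite opprK mulnS => /(filtVprime l_pr) Il; case/negP: nIk.
by apply: filt_le Il; rewrite !ltnS leq_pmull.
Qed.

Lemma in_kernel_torsion_free (P : curve_point E) n :
  (0 < n)%N -> in_kernel 1 (pval P) -> P *+ n = 0 -> P = 0.
Proof.
elim/ltn_ind: n P => n IHn P n0 kP Pn0.
case: (leqP n 1) => [n1|n1].
  by move: Pn0; have -> : n = 1%N by apply/eqP; rewrite eqn_leq n1 n0.
have l_pr := pdiv_prime n1; have l_dvd := pdiv_dvd n.
apply: (IHn (n %/ pdiv n)%N) => //.
- by rewrite ltn_Pdiv // prime_gt1.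
- by rewrite divn_gt0 ?pdiv_gt0 // dvdn_leq.
- apply: (in_kernel_prime_torsion_free l_pr); first exact: in_kernel_mul.
  by rewrite -mulrnA divnK.
Qed.

End Formal.

(** * Reduction modulo p *)

Section Reduction.
Variables (F : fieldType) (I : filtration F) (a b : F).
Hypotheses (pa : I 0%N a) (pb : I 0%N b).
Variable E : smooth_curve F.
Hypothesis defE : curve_of E = WCurve 0 a 0 b 0.

Lemma in_kernel_intro x y : on_curve E (Some (x, y)) -> y != 0 ->
  I 1%N (x / y) -> I 3%N y^-1 -> in_kernel I a b 1 (Some (x, y)).
Proof.
rewrite defE /= => /eqP c y0 Iz Iw; exists (x / y), y^-1; split.
  split=> //; rewrite /zw_curve; apply/subr0_eq; move: c.
  rewrite !mul0r !addr0 => c.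
  transitivity ((y ^+ 2 - (x ^+ 3 + a * x ^+ 2 + b * x)) / y ^+ 3).
    by field.
  by rewrite c subrr mul0r.
by rewrite /zw_point invr_eq0 (negPf y0) !invrK divfK.
Qed.

(** If x is not integral, then y^2 = x^3 U with U a unit, so (x / y)^2 = 1 / (x U) and 1 / y = (x /
    y)^3 U. *)
Lemma in_kernelP x y : on_curve E (Some (x, y)) ->
  (I 0%N x /\ I 0%N y) \/ in_kernel I a b 1 (Some (x, y)).
Proof.
move=> cP; have := cP; rewrite defE /= !mul0r !addr0 => /eqP c.
case: (boolP (I 0%N x)) => [Ix|nx].
  left; split=> //; apply: filt_sqr; rewrite c.
  apply: filtD; last exact: filtM0.
  by apply: filtD; [exact: filtX0|apply: filtM0 => //; exact: filtX0].
right; have It := filt_inv1 nx; have I0t := filtW It.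
have x0 : x != 0 by apply/eqP => e; rewrite e filt0 in nx.
pose U := 1 + (a * x^-1 + b * x^-1 ^+ 2).
have IaU : I 1%N (a * x^-1 + b * x^-1 ^+ 2).
  by apply: filtD; apply: filtM0 => //; rewrite expr2; apply: filtM0.
have uU : ~~ I 1%N U by apply: filt_unitD; rewrite ?filt_unit1.
have I0U : I 0%N U by apply: filtD; rewrite ?filt1 ?(filtW IaU).
have U0 : U != 0 by apply: contraNneq uU => ->; apply: filt0.
have yU : y ^+ 2 = x ^+ 3 * U by rewrite c /U; field.
have y0 : y != 0.
  have : y ^+ 2 != 0 by rewrite yU mulf_neq0 ?expf_neq0.
  by rewrite expf_eq0.
have Iz : I 1%N (x / y).
  apply: filt_sqr1; rewrite expr_div_n yU.
  have -> : x ^+ 2 / (x ^+ 3 * U) = x^-1 * U^-1 by field; rewrite x0 U0.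
  by apply: filtMr => //; apply: filt_inv.
apply: in_kernel_intro => //.
have -> : y^-1 = x / y * (x / y) * (x / y) * U.
  transitivity (x ^+ 3 * U / y ^+ 3); last by field.
  by rewrite -yU; field.
by apply: filtMr => //; apply: (@filtM _ _ 2 1) => //; apply: (@filtM _ _ 1 1).
Qed.

(** In odd residue characteristic a singular point of the reduction has y = 0, so only common zeros
    of the cubic and its derivative have to be excluded. *)
Hypothesis good : forall x, I 0%N x -> I 1%N (x ^+ 3 + a * x ^+ 2 + b * x) ->
  ~~ I 1%N (3%:R * x ^+ 2 + 2%:R * a * x + b).

(** The line through P and -Q has slope l with l (x1 - x2) = y1 + y2 and l (y1 - y2) = g, where g is
    congruent to the derivative of the cubic at x1. If y1 is a unit so is y1 + y2 = 2 y1 - (y1 -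
    y2); otherwise g is a unit by [good]. Either way 1 / l is divisible by the uniformizer, and the
    third intersection, with x of order l^2 and y of order l^3, lies in the kernel. *)
Lemma in_kernel_sub x1 y1 x2 y2 :
  on_curve E (Some (x1, y1)) -> on_curve E (Some (x2, y2)) ->
  I 0%N x1 -> I 0%N y1 -> I 1%N (x1 - x2) -> I 1%N (y1 - y2) ->
  in_kernel I a b 1 (padd E (Some (x1, y1)) (pneg E (Some (x2, y2)))).
Proof.
move=> cP cQ Ix1 Iy1 Idx Idy.
case: (eqVneq (neg_affine E (x2, y2)) (neg_affine E (x1, y1))) => [e|/eqP nPQ].
  rewrite [pneg _ _](congr1 Some e) (paddpN E (Some (x1, y1))).
  exists 0, 0; rewrite /zw_point eqxx; split=> //.
  by split; rewrite ?filt0 // /zw_curve; ring.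
have cQ' : on_curve E (Some (neg_affine E (x2, y2))).
  by rewrite (on_curve_pneg E (Some (x2, y2))).
have [l [m [[x3 y3] [sPQT ->]]]] :=
  line_section_padd (@smooth_curveP _ E) cP cQ' nPQ.
have cT : on_curve E (Some (x3, y3)).
  exact: line_section_on_curve (line_sectionC (line_sectionCr sPQT)).
have cR := cT; rewrite -(on_curve_pneg E) in cR.
set R := pneg E (Some (x3, y3)) in cR *.
have [] := sPQT; rewrite /on_line /neg_affine /= defE /= =>
  -[ey1 ey2 ey3] e1 e2 e3.
have Ix2 : I 0%N x2 by rewrite -[x2](subKr x1); apply: filtB => //;
  apply: filtW Idx.
have {}e1 : l ^+ 2 = x1 + x2 + x3 + a by rewrite e1; ring.
have lx : l * (x1 - x2) = y1 + y2.
  transitivity ((l * x1 + m) - (l * x2 + m)); first by ring.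
  by rewrite -ey1 -ey2; ring.
pose g := x1 ^+ 2 + x1 * x2 + x2 ^+ 2 + a * (x1 + x2) + b.
have ly : l * (y1 - y2) = g.
  transitivity (l * ((l * x1 + m) + (l * x2 + m))).
    by rewrite -ey1 -ey2; ring.
  transitivity (l ^+ 2 * (x1 + x2) + 2%:R * l * m); first by ring.
  have -> : 2%:R * l * m = b - (x1 * x2 + x1 * x3 + x2 * x3) by rewrite e2;
    ring.
  by rewrite e1 /g; ring.
have [l0 It] : l != 0 /\ I 1%N l^-1.
  case: (boolP (I 1%N y1)) => [I1y1|uy1].
    have Ic : I 1%N (x1 ^+ 3 + a * x1 ^+ 2 + b * x1).
      move: cP; rewrite defE /= !mul0r !addr0 => /eqP <-.
      by rewrite expr2; apply: filtM0.
    have eg : g = (3%:R * x1 ^+ 2 + 2%:R * a * x1 + b)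
                - (x1 - x2) * (2%:R * x1 + x2 + a) by rewrite /g; ring.
    have Id2 : I 1%N ((x1 - x2) * (2%:R * x1 + x2 + a)).
      apply: filtMr => //; apply: filtD => //; apply: filtD => //.
      by apply: filtM0 => //; apply: filt_nat.
    have ug : ~~ I 1%N g.
      by rewrite eg; apply: filt_unitD; [exact: good|apply: filtN].
    have Ig : I 0%N g.
      do ?[apply: filtD|apply: filtX0|apply: filtM0] => //.
    have g0 : g != 0 by apply: contraNneq ug => ->; apply: filt0.
    have l0 : l != 0 by apply: contraNneq g0 => l0; rewrite -ly l0 mul0r.
    split=> //; have -> : l^-1 = (y1 - y2) * g^-1.
      by apply: (mulfI l0); rewrite mulfV // mulrA ly mulfV.
    by apply: filtMr => //; apply: filt_inv.
  have Iy2 : I 0%N y2 by rewrite -[y2](subKr y1); apply: filtB => //;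
    apply: filtW Idy.
  have us : ~~ I 1%N (y1 + y2).
    have -> : y1 + y2 = 2%:R * y1 + (- (y1 - y2)) by ring.
    apply: filt_unitD; last exact: filtN.
    by apply: filt_unitM; rewrite ?filt_unit2 ?filt_nat.
  have Is : I 0%N (y1 + y2) by apply: filtD.
  have s0 : y1 + y2 != 0 by apply: contraNneq us => ->; apply: filt0.
  have l0 : l != 0 by apply: contraNneq s0 => l0; rewrite -lx l0 mul0r.
  split=> //; have -> : l^-1 = (x1 - x2) * (y1 + y2)^-1.
    by apply: (mulfI l0); rewrite mulfV // mulrA lx mulfV.
  by apply: filtMr => //; apply: filt_inv.
set t := l^-1 in It; have I0t := filtW It.
have el : l = t^-1 by rewrite invrK.
have t0 : t != 0 by rewrite invr_eq0.
have It2 : I 2%N (t ^+ 2) by rewrite expr2; apply: (@filtM _ _ 1 1).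
have It3 : I 3%N (t ^+ 3) by rewrite exprS; apply: (@filtM _ _ 1 2).
have I1 k u : I k.+1 u -> I 1%N u by apply: filt_le.
(* The third point is (X / t^2, Y / t^3) with t = 1 / l, X integral and Y a unit. *)
pose X := 1 + - ((a + x1 + x2) * t ^+ 2).
pose Y := 1 + (- ((a + 2%:R * x1 + x2) * t ^+ 2) + y1 * t ^+ 3).
have I12 : I 0%N (a + x1 + x2) by do !apply: filtD.
have I112 : I 0%N (a + 2%:R * x1 + x2).
  by do !apply: filtD => //; apply: filtM0 => //; apply: filt_nat.
have IX : I 0%N X.
  apply: filtD; rewrite ?filt1 //; apply: filtN; apply: filtM0 => //.
  exact: filtW It2.
have IY1 : I 1%N (- ((a + 2%:R * x1 + x2) * t ^+ 2) + y1 * t ^+ 3).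
  apply: filtD; first by apply: filtN; apply: filtM0 => //; apply: I1 It2.
  by apply: filtM0 => //; apply: I1 It3.
have IY : I 0%N Y by apply: filtD; rewrite ?filt1 // (filtW IY1).
have uY : ~~ I 1%N Y by apply: filt_unitD; rewrite ?filt_unit1.
have Y0 : Y != 0 by apply: contraNneq uY => ->; apply: filt0.
have ex3 : x3 = X / t ^+ 2.
  have -> : x3 = l ^+ 2 - a - x1 - x2 by rewrite e1; ring.
  by rewrite el /X; field.
have ey3' : y3 = Y / t ^+ 3.
  have -> : y3 = l * (x3 - x1) + y1 by rewrite ey3 ey1; ring.
  by rewrite ex3 el /X /Y; field.
have y30 : y3 != 0 by rewrite ey3' mulf_neq0 ?invr_eq0 ?expf_neq0.
have eR : R = Some (x3, - y3).
  by rewrite /R /pneg /neg_affine /= defE /=; congr (Some (_, _)); ring.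
rewrite eR in cR *; apply: in_kernel_intro; rewrite ?oppr_eq0 //.
  have -> : x3 / - y3 = - t * (X / Y) by rewrite ex3 ey3'; field;
    rewrite oppr_eq0 t0 Y0.
  apply: filtMr; first exact: filtN.
  by apply: filtM0 => //; apply: filt_inv.
have -> : (- y3)^-1 = - t ^+ 3 * Y^-1 by rewrite ey3'; field;
  rewrite ?oppr_eq0 t0 Y0.
by apply: filtMr; [exact: filtN|apply: filt_inv].
Qed.

End Reduction.

(** * Torsion of y^2 = x (x + A) (x + B) *)

Section TwoGenerated.
Variables (V : zmodType) (T P : V) (N : nat).
Hypotheses (N0 : (0 < N)%N) (T2 : T *+ 2 = 0) (P2N : P *+ (2 * N) = 0).

Lemma mulrn_modn (v : V) n m : v *+ n = 0 -> v *+ (m %% n) = v *+ m.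
Proof.
by move=> vn; rewrite {2}(divn_eq m n) mulrnDr mulnC mulrnA vn mul0rn add0r.
Qed.

Definition two_gen (s : 'Z_2 * 'Z_(2 * N)) : V := T *+ s.1 + P *+ s.2.

Lemma Z2N_cast : ((Zp_trunc (2 * N)).+2 = 2 * N)%N.
Proof. by rewrite Zp_cast //; move: N0; clear; case: N => // n _;
  rewrite mulnS. Qed.

Lemma two_genD s t : two_gen (s + t) = two_gen s + two_gen t.
Proof.
rewrite /two_gen /= (mulrn_modn _ T2) mulrnDr.
have -> : P *+ ((s.2 + t.2) %% (Zp_trunc (2 * N)).+2) = P *+ (s.2 + t.2).
  by apply: mulrn_modn; rewrite Z2N_cast.
by rewrite mulrnDr addrACA.
Qed.

Hypotheses (T0 : T <> 0) (TN : P *+ N <> T)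
  (P_order : forall j, (0 < j < 2 * N)%N -> P *+ j <> 0).

(** A relation T + jP = 0 doubles to 2jP = 0, which leaves j = 0 or j = N; these contradict [T0] and
    [TN]. *)
Lemma two_gen_inj : injective two_gen.
Proof.
move=> s t est; apply/subr0_eq; have : two_gen (s - t) = 0.
  by apply: (addIr (two_gen t)); rewrite -two_genD subrK add0r.
case: (s - t) => [[i i2] [j j2]] {s t est}; rewrite /two_gen /= => h.
have j2N : (j < 2 * N)%N by rewrite -Z2N_cast.
suff [ei ej] : i = 0%N /\ j = 0%N.
  by congr pair; apply: val_inj; rewrite /= ?ei ?ej.
have Nj k : (0 < k)%N -> (k < 2 * N)%N -> P *+ k <> 0.
  by move=> k0 k2; apply: P_order; rewrite k0.
have small k : (k < 2 * N)%N -> P *+ k = 0 -> k = 0%N.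
  by case: k => // k k2 e; case: (Nj k.+1).
case: i i2 h => [|[|//]] _ h.
  by split=> //; apply: small => //; move: h; rewrite mulr0n add0r.
have h2 : P *+ (2 * j) = 0.
  have : (T *+ 1 + P *+ j) *+ 2 = 0 by rewrite h mul0rn.
  by rewrite mulrnDl mulr1n T2 add0r -mulrnA mulnC.
case: (ltngtP j N) => [jN|jN|jN].
- have /eqP : (2 * j = 0)%N by apply: small => //; rewrite ltn_pmul2l.
  by rewrite muln_eq0 /= => /eqP j0; move: h; rewrite j0 mulr0n addr0.
- have : (2 * j - 2 * N = 0)%N.
    have le2 : (2 * N <= 2 * j)%N by rewrite leq_pmul2l // ltnW.
    apply: small; first by rewrite ltn_subLR // addnn -mul2n ltn_pmul2l.
    by rewrite mulrnBr // h2 P2N subrr.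
  by move/eqP; rewrite subn_eq0 leq_pmul2l // leqNgt jN.
- case: TN; have TT : - T = T.
    by apply: (addrI T); rewrite subrr -mulr2n T2.
  by rewrite -jN -TT; apply: (addrI T); rewrite subrr -[T in LHS]mulr1n.
Qed.

Lemma two_gen_torsion s : two_gen s *+ (2 * N) = 0.
Proof.
rewrite /two_gen mulrnDl -!mulrnA [X in T *+ X]mulnCA [X in P *+ X]mulnC.
by rewrite (mulrnA T) (mulrnA P) T2 P2N !mul0rn addr0.
Qed.

End TwoGenerated.

Section ResidueClasses.
Variables (p : nat) (p_pr : prime p).

Lemma pint_residue x : pint p 0 x -> exists c : 'I_p, pint p 1 (x - c%:R).
Proof.
move=> /(pintP p_pr)[n [d [pd ->]]]; rewrite expr0 mul1r.
have d0 : d != 0 by apply: contraL (pd) => /eqP->; rewrite dvdn0.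
have p0 : p%:Z != 0 by rewrite eqz_nat -lt0n prime_gt0.
have : coprimez d p by rewrite /coprimez /gcdz eqz_nat -/(coprime _ _)
  coprime_sym prime_coprime.
case/coprimezP=> -[u v] /= uv.
have cp : (`|((n * u) %% p)%Z| < p)%N.
  by rewrite -ltz_nat gez0_abs ?modz_ge0 // ltz_pmod // ltz_nat prime_gt0.
exists (Ordinal cp) => /=.
have -> : n%:~R / d%:~R - `|((n * u) %% p)%Z|%:R =
    p%:R ^+ 1 * (n * v + ((n * u) %/ p)%Z * d)%:~R / d%:~R :> rat.
  apply: (mulIf (_ : d%:~R != 0 :> rat)); first by rewrite intr_eq0.
  rewrite mulrBl !divfK ?intr_eq0 // expr1.
  have -> : `|((n * u) %% p)%Z|%:R = ((n * u) %% p)%Z%:~R :> rat.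
    by rewrite -[RHS]/(_ %:~R) -{2}[((n * u) %% p)%Z]gez0_abs ?modz_ge0.
  have -> : ((n * u) %% p)%Z = n * u - ((n * u) %/ p)%Z * p.
    by rewrite {2}(divz_eq (n * u) p) addrC addKr.
  rewrite -{1}[n]mulr1 -uv !(intrD, intrM, intrB, mulrDr, mulrDl, rmorphN) /=.
  ring.
by apply/(pintP p_pr); eexists _, d.
Qed.

End ResidueClasses.

Definition legendre (F : fieldType) (A B : F) : wcurve F :=
  WCurve 0 (A + B) 0 (A * B) 0.

Lemma legendre_smooth (A B : rat) : A != 0 -> B != 0 -> A != B -> smooth
  (legendre A B).
Proof.
move=> A0 B0 AB x y /eqP /= c /eqP; rewrite !mul0r !addr0 in c *.
rewrite mulf_eq0 => /orP[//|/eqP y0]; move: c; rewrite y0 => c.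
have /eqP : x * (x + A) * (x + B) = 0.
  by transitivity (0 ^+ 2 : rat); [rewrite c|]; ring.
rewrite !mulf_eq0 -orbA => /or3P[/eqP->|/eqP h|/eqP h].
- by rewrite (_ : _ + _ = A * B) ?mulf_neq0 //; ring.
- have -> : x = - A by rewrite -[LHS]subr0 -h; ring.
  by rewrite (_ : _ + _ = A * (A - B)) ?mulf_neq0 ?subr_eq0 //; ring.
- have -> : x = - B by rewrite -[LHS]subr0 -h; ring.
  by rewrite (_ : _ + _ =
    B * (B - A)) ?mulf_neq0 ?subr_eq0 // 1?[B == A]eq_sym //; ring.
Qed.

(** Residues are natural numbers below p so that the points can be counted by evaluation. *)
Definition mod_points (p A B : nat) : seq (nat * nat) :=
  [seq u <- [seq (x, y) | x <- iota 0 p, y <- iota 0 p] |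
   u.2 * u.2 == u.1 * (u.1 + A) * (u.1 + B) %[mod p]]%N.

Section LegendreTorsion.
Variables (p : nat) (p_pr : prime p) (p_odd : odd p) (A B : int).
Hypothesis p_good : ~~ (p %| `|(A * B * (A - B))%R|)%N.
Variable E : smooth_curve rat.
Hypothesis defE : curve_of E = legendre A%:~R B%:~R.

Let I := pfiltration p_pr p_odd.
Let a : rat := A%:~R + B%:~R.
Let b : rat := A%:~R * B%:~R.

Let unitA : ~~ I 1%N A%:~R.
Proof.
apply: contra p_good; rewrite /= pintS_int // expn1 !abszM -mulnA => h.
exact: dvdn_mulr.
Qed.

Let unitB : ~~ I 1%N B%:~R.
Proof.
apply: contra p_good; rewrite /= pintS_int // expn1 !abszM => h.
by rewrite dvdn_mulr // dvdn_mull.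
Qed.

Let unitAB : ~~ I 1%N (A%:~R - B%:~R).
Proof.
apply: contra p_good; rewrite -rmorphB /= pintS_int // expn1 !abszM => h.
exact: dvdn_mull.
Qed.

Let IA : I 0%N A%:~R. Proof. exact: pint_int. Qed.
Let IB : I 0%N B%:~R. Proof. exact: pint_int. Qed.
Let Ia : I 0%N a. Proof. exact: filtD. Qed.
Let Ib : I 0%N b. Proof. exact: filtM0. Qed.

Let good x : I 0%N x -> I 1%N (x ^+ 3 + a * x ^+ 2 + b * x) ->
  ~~ I 1%N (3%:R * x ^+ 2 + 2%:R * a * x + b).
Proof.
move=> Ix; have -> : x ^+ 3 + a * x ^+ 2 + b * x =
  x * ((x + A%:~R) * (x + B%:~R)).
  by rewrite /a /b; ring.
have IxA := filtD Ix IA; have IxB := filtD Ix IB.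
have -> : 3%:R * x ^+ 2 + 2%:R * a * x + b = (x + A%:~R) * (x + B%:~R)
   + x * (x + A%:~R) + x * (x + B%:~R) by rewrite /a /b; ring.
case/(filt_prime Ix) => [I1x|/(filt_prime IxA)[I1xA|I1xB]].
- rewrite -addrA; apply: filt_unitD; last by apply: filtD; apply: filtMr.
  by apply: filt_unitM; rewrite // addrC; apply: filt_unitD.
- rewrite addrC; apply: filt_unitD.
    have ux : ~~ I 1%N x.
      by apply: contra unitA => /(filtB I1xA); rewrite addrC addKr.
    apply: filt_unitM => //;
      have -> : x + B%:~R = - (A%:~R - B%:~R) + (x + A%:~R) by ring.
    by apply: filt_unitD => //; apply: contra unitAB => /filtN; rewrite opprK.
  by apply: filtD; [apply: filtMr|apply: filtM0].
- rewrite -addrA addrCA; apply: filt_unitD.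
    have ux : ~~ I 1%N x.
      by apply: contra unitB => /(filtB I1xB); rewrite addrC addKr.
    apply: filt_unitM => //;
      have -> : x + A%:~R = (A%:~R - B%:~R) + (x + B%:~R) by ring.
    exact: filt_unitD.
  by apply: filtD; apply: filtM0.
Qed.

Definition residue_of (P : curve_point E) (r : option (nat * nat)) : Prop :=
  if r is Some (c, d) then exists x y, [/\ pval P = Some (x, y),
    I 0%N x /\ I 0%N y & I 1%N (x - c%:R) /\ I 1%N (y - d%:R)]
  else in_kernel I a b 1 (pval P).

Lemma residue_exists P (A0 B0 : nat) :
  I 1%N (A%:~R - A0%:R) -> I 1%N (B%:~R - B0%:R) ->
  exists2 r, r \in None :: map Some (mod_points p A0 B0) & residue_of P r.
Proof.
move=> IA0 IB0; case: P => -[[x y]|] cP; last first.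
  by exists None => //; exists 0, 0; rewrite /zw_point eqxx; split=> //;
     split; rewrite ?filt0 // /zw_curve; ring.
have [[Ix Iy]|k] := in_kernelP Ia Ib defE cP; last by exists None.
have [c Ic] := pint_residue p_pr Ix; have [d Id] := pint_residue p_pr Iy.
exists (Some (val c, val d)); last by exists x, y.
rewrite inE /= mem_map; last by move=> u v [].
rewrite mem_filter allpairs_f ?mem_iota ?add0n ?ltn_ord // andbT /=.
have Ic0 : I 0%N c%:R := filt_nat _ _; have Id0 : I 0%N d%:R := filt_nat _ _.
have IA00 : I 0%N A0%:R := filt_nat _ _;
  have IB00 : I 0%N B0%:R := filt_nat _ _.
move: cP; rewrite defE /= !mul0r !addr0 => /eqP ec.
have : I 1%N ((c * (c + A0) * (c + B0))%N%:R - (d * d)%N%:R).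
  rewrite !(natrM, natrD).
  (* The coordinates and parameters are replaced by their residues one factor at a time; the last
     term is the equation of the curve. *)
  have -> : c%:R * (c%:R + A0%:R) * (c%:R + B0%:R) - d%:R * d%:R =
    (y - d%:R) * (y + d%:R)
    - (x - c%:R) * ((x + A%:~R) * (x + B%:~R))
    - c%:R * ((x - c%:R) + (A%:~R - A0%:R)) * (x + B%:~R)
    - c%:R * (c%:R + A0%:R) * ((x - c%:R) + (B%:~R - B0%:R))
    - (y ^+ 2 - (x ^+ 3 + (A%:~R + B%:~R) * x ^+ 2 + A%:~R * B%:~R * x)) :>
        rat by ring.
  rewrite ec subrr subr0.
  apply: filtB; first (apply: filtB; first apply: filtB).
  - by apply: filtMr => //; apply: filtD.
  - by apply: filtMr => //; apply: filtM0; apply: filtD.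
  - by apply: filtMr; [apply: filtM0 => //; apply: filtD|apply: filtD].
  - by apply: filtM0; [apply: filtM0 => //; apply: filtD|apply: filtD].
have -> : (c * (c + A0) * (c + B0))%N%:R - (d * d)%N%:R =
   ((c * (c + A0) * (c + B0))%N%:Z - (d * d)%N%:Z)%:~R :> rat
     by rewrite rmorphB.
rewrite /= pintS_int // expn1 => h; apply/eqP/eqP.
rewrite -eqz_nat -!modz_nat eq_sym; apply/eqP/eqP; rewrite eqz_mod_dvd.
exact: h.
Qed.

Lemma residue_inj P Q r n : (0 < n)%N -> P *+ n = 0 -> Q *+ n = 0 ->
  residue_of P r -> residue_of Q r -> P = Q.
Proof.
have tf := in_kernel_torsion_free Ia Ib defE.
move=> n0 Pn Qn; case: r => [[c d]|] /=; last first.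
  by move=> /(tf _ _ n0)/(_ Pn)-> /(tf _ _ n0)/(_ Qn)->.
case=> x [y [eP [Ix Iy] [Ixc Iyd]]] [x' [y' [eQ [Ix' Iy'] [Ixc' Iyd']]]].
apply/subr0_eq; apply: (tf _ _ n0); last by rewrite mulrnBl Pn Qn subrr.
rewrite pvalD pvalN eP eQ; apply: (in_kernel_sub Ia Ib defE good) => //.
- by rewrite -eP pvalP.
- by rewrite -eQ pvalP.
- by have -> : x - x' = (x - c%:R) - (x' - c%:R) by [ring]; apply: filtB.
- by have -> : y - y' = (y - d%:R) - (y' - d%:R) by [ring]; apply: filtB.
Qed.

(** The 4N known points lie in distinct residue classes, and there are at most 4N classes: the
    kernel and fewer than 4N affine ones. So every class contains a known point, and a torsion point
    equals the known point of its class. *)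
Theorem legendre_torsion (A0 B0 N : nat) (T P : curve_point E) :
  I 1%N (A%:~R - A0%:R) -> I 1%N (B%:~R - B0%:R) ->
  (0 < N)%N -> (size (mod_points p A0 B0) < 4 * N)%N ->
  T *+ 2 = 0 -> P *+ (2 * N) = 0 -> T <> 0 -> P *+ N <> T ->
  (forall j, (0 < j < 2 * N)%N -> P *+ j <> 0) ->
  torsion_isog ('Z_2 * 'Z_(2 * N))%type (legendre A%:~R B%:~R).
Proof.
move=> hA hB N0 few T2 P2N T0 TN ordP.
pose phi := two_gen T P (N := N).
have injphi : injective phi by apply: two_gen_inj.
exists (fun s => pval (phi s)); rewrite /group_iso_onto -defE; split.
- by move=> s t /pval_inj/injphi.
- by move=> s t; rewrite -pvalD /phi two_genD.
apply/seteqP; split=> [_ [s _ <-]|Q [cQ [n [n0 Qn0]]]].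
  split; first exact: pvalP.
  exists (2 * N)%N; split; first by rewrite muln_gt0.
  by rewrite -pvalMn two_gen_torsion.
have red (R : curve_point E) := residue_exists R hA hB.
have /fin_all_exists2[f fS fR] s := red (phi s).
pose L := [seq f s | s : 'Z_2 * 'Z_(2 * N)].
have injf : injective f.
  move=> s t est; apply: injphi; apply: (@residue_inj _ _ (f s) (2 * N)).
  - by rewrite muln_gt0.
  - exact: two_gen_torsion.
  - exact: two_gen_torsion.
  - exact: fR.
  - by rewrite est; apply: fR.
pose Qc := CurvePoint cQ.
have [r rS Qr] := red Qc.
have sL : size L = (4 * N)%N.
  by rewrite size_map -cardE card_prod !card_ord Z2N_cast // mulnA.
have uL : uniq L by rewrite map_inj_uniq ?enum_uniq.
have subL : {subset L <= None :: map Some (mod_points p A0 B0)}.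
  by move=> _ /mapP[s _ ->].
have [|_ eL] := uniq_min_size uL subL; first by rewrite /= size_map sL.
move: rS; rewrite -eL => /mapP[s _ er].
exists s => //; have e : phi s = Qc.
  (* A common exponent of the known point and of Q. *)
  apply: (@residue_inj _ _ r (n * (2 * N))).
  - by rewrite !muln_gt0 n0.
  - by rewrite mulnC mulrnA two_gen_torsion // mul0rn.
  - rewrite mulrnA; have -> : Qc *+ n = 0 by apply: pval_inj; rewrite pvalMn.
    by rewrite mul0rn.
  - by rewrite er; apply: fR.
  - exact: Qr.
exact: (congr1 (@pval _ _) e).
Qed.

End LegendreTorsion.

(** * Explicit torsion points and the minimal model *)

Section Orders.
Variable V : zmodType.

Lemma mulrn_gcdn (v : V) m n :
  (0 < m)%N -> v *+ m = 0 -> v *+ n = 0 -> v *+ gcdn m n = 0.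
Proof.
move=> m0 vm vn; case: (egcdnP n m0) => km kn e _.
have : v *+ (km * m) = 0 by rewrite mulnC mulrnA vm mul0rn.
by rewrite e mulrnDr [(kn * n)%N]mulnC mulrnA vn mul0rn add0r.
Qed.

(** For N up to 4 every proper divisor of 2N divides N, except 2 when N = 3. *)
Lemma order_2N (v : V) N : (1 <= N <= 4)%N -> v *+ N <> 0 ->
  (N = 3%N -> v *+ 2 <> 0) -> v *+ (2 * N) = 0 ->
  forall j, (0 < j < 2 * N)%N -> v *+ j <> 0.
Proof.
move=> hN vN v2 v2N j /andP[j0 j2N] vj.
have vg := mulrn_gcdn j0 vj v2N.
have : [|| gcdn j (2 * N) %| N | (N == 3) && (gcdn j (2 * N) == 2)]%N.
  by case: N hN j2N {vN v2 v2N vg} => [|[|[|[|[|]]]]] // _;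
     case: j j0 {vj} => [|[|[|[|[|[|[|[|]]]]]]]].
case/orP=> [/dvdnP[k eN]|/andP[/eqP eN /eqP e2]].
  by case: vN; rewrite eN mulnC mulrnA vg mul0rn.
by apply: (v2 eN); rewrite -e2.
Qed.

End Orders.

Section ExplicitPoints.
Variables (A B : rat) (E : smooth_curve rat).
Hypothesis defE : curve_of E = legendre A B.

Lemma on_curve_root x : x * (x + A) * (x + B) = 0 -> on_curve E (Some (x, 0)).
Proof.
move=> e; rewrite defE /=; apply/eqP.
by transitivity (x * (x + A) * (x + B)); [rewrite e|]; ring.
Qed.

Fact origin_on_curve : on_curve E (Some (0, 0)).
Proof. by apply: on_curve_root; ring. Qed.

Fact opp_root_on_curve : on_curve E (Some (- A, 0)).
Proof. by apply: on_curve_root; ring. Qed.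

Definition origin : curve_point E := CurvePoint origin_on_curve.
Definition opp_root : curve_point E := CurvePoint opp_root_on_curve.

Lemma two_torsion (P : curve_point E) x : pval P = Some (x, 0) -> P *+ 2 = 0.
Proof.
move=> eP; rewrite mulr2n -[P in X in X + _]opprK; apply/eqP.
rewrite addrC subr_eq0; apply/eqP/pval_inj.
rewrite pvalN eP defE /pneg /neg_affine /=; congr (Some (_, _)); ring.
Qed.

(** The classical criterion: a point is divisible by 2 when its abscissa differs from each root of
    the cubic by a square. The tangent at Q has slope r0 + r1 + r2 and meets the curve again at
    -P. *)
Lemma halving r0 r1 r2 (P : curve_point E) :
  r1 ^+ 2 = r0 ^+ 2 + A -> r2 ^+ 2 = r0 ^+ 2 + B ->
  pval P = Some (r0 ^+ 2, r0 * r1 * r2) ->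
  exists Q : curve_point E, Q *+ 2 = P /\
    pval Q = Some (r0 ^+ 2 + r0 * r1 + r0 * r2 + r1 * r2,
                   (r0 + r1) * (r0 + r2) * (r1 + r2)).
Proof.
move=> e1 e2 eP; have eA : A = r1 ^+ 2 - r0 ^+ 2 by rewrite e1; ring.
have eB : B = r2 ^+ 2 - r0 ^+ 2 by rewrite e2; ring.
pose l := r0 + r1 + r2.
pose Q := (r0 ^+ 2 + r0 * r1 + r0 * r2 + r1 * r2,
           (r0 + r1) * (r0 + r2) * (r1 + r2)).
have sQ : line_section E l (- (r0 * r1 * r2) - l * r0 ^+ 2) Q Q
            (r0 ^+ 2, - (r0 * r1 * r2)).
  split; rewrite ?defE /on_line /Q /l /= ?eA ?eB; [split| | |]; ring.
exists (CurvePoint (line_section_on_curve sQ)); split=> //.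
apply: pval_inj; rewrite mulr2n pvalD.
apply: etrans (padd_line_section (@smooth_curveP _ E) sQ) _.
by rewrite eP defE /pneg /neg_affine /=; congr (Some (_, _)); ring.
Qed.

Lemma flex_point q : A = 1 + 2%:R * q -> B = q ^+ 3 * (q + 2%:R) ->
  exists R : curve_point E, R *+ 3 = 0 /\ R <> 0.
Proof.
move=> eA eB; pose l := 1 + q + q ^+ 2.
pose R := (q ^+ 2, q ^+ 2 * (1 + q) ^+ 2).
have sR : line_section E l (R.2 - l * R.1) R R R.
  split; rewrite ?defE /on_line /R /l /= ?eA ?eB; [split| | |]; ring.
pose R' := CurvePoint (line_section_on_curve sR).
exists R'; split; last by move/(congr1 (@pval _ _)).
have e : R' *+ 2 = - R'.
  apply: pval_inj; rewrite mulr2n pvalD pvalN.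
  exact: (padd_line_section (@smooth_curveP _ E) sR).
by rewrite mulrSr e addNr.
Qed.

End ExplicitPoints.

(** * The change of coordinates to the minimal model *)

Section Transport.
Variables (F : numFieldType) (al be : F).

(** The result of x = 4 X, y = 8 Y + 4 X and division by 64. The coefficients (A + B - 1) / 4 and A
    B / 16 are integral because A = 1 mod 4 and 16 divides B. *)
Definition minimal_frey : wcurve F :=
  WCurve 1 (al + 4%:R * be) 0 ((1 + 4%:R * al) * be) 0.

Let A := 1 + 4%:R * al.
Let B := 16%:R * be.

Definition to_minimal (P : F * F) : F * F :=
  (P.1 / 4%:R, (P.2 - P.1) / 8%:R).

Definition of_minimal (P : F * F) : F * F :=
  (4%:R * P.1, 8%:R * P.2 + 4%:R * P.1).

Lemma to_minimalK : cancel to_minimal of_minimal.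
Proof. by case=> x y; congr pair; rewrite /=; field. Qed.

Lemma of_minimalK : cancel of_minimal to_minimal.
Proof. by case=> x y; congr pair; rewrite /=; field. Qed.

Lemma on_curve_to_minimal P :
  on_curve minimal_frey (omap to_minimal P) = on_curve (legendre A B) P.
Proof.
case: P => [[x y]|] //=; rewrite -subr_eq0 -[RHS]subr_eq0.
have n64 : 64%:R^-1 != 0 :> F by rewrite invr_eq0 pnatr_eq0.
rewrite -[RHS](mulrI_eq0 _ (mulfI n64)).
by congr (_ == 0); rewrite /A /B; field.
Qed.

Hypothesis smAB : smooth (legendre A B).

Lemma minimal_smooth : smooth minimal_frey.
Proof.
move=> x y c h; apply/negP => /eqP h'.
have c' : on_curve (legendre A B) (Some (of_minimal (x, y))).
  by rewrite -on_curve_to_minimal [omap _ _](congr1 Some (of_minimalK (x, y))).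
have := @smAB _ _ c'.
move: h h'; rewrite /= !addr0 mul1r => h h'.
have -> : 2%:R * (8%:R * y + 4%:R * x) + 0 * (4%:R * x) = 0.
  by transitivity (8%:R * (2%:R * y + x)); [ring|rewrite h mulr0].
move=> /(_ erefl) /negP[]; apply/eqP.
transitivity (16%:R * (3%:R * x ^+ 2 + 2%:R * (al + 4%:R * be) * x
   + (1 + 4%:R * al) * be - 1 * y) + 8%:R * (2%:R * y + x)).
  by rewrite /A /B; ring.
by rewrite h h' !mulr0 addr0.
Qed.

Lemma to_minimalD P Q :
  on_curve (legendre A B) P -> on_curve (legendre A B) Q ->
  omap to_minimal (padd (legendre A B) P Q) =
  padd minimal_frey (omap to_minimal P) (omap to_minimal Q).
Proof.
case: P Q => [P|] [Q|] cP cQ; rewrite ?paddp0 //.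
have neg R : to_minimal (neg_affine (legendre A B) R) =
             neg_affine minimal_frey (to_minimal R).
  by congr pair; rewrite /=; field.
have [->|/eqP nPQ] := eqVneq Q (neg_affine (legendre A B) P).
  rewrite [omap _ (Some (neg_affine _ _))]/= neg.
  by rewrite (paddpN _ (Some P)) (paddpN _ (Some (to_minimal P))).
have [l [m [T [s e]]]] := line_section_padd smAB cP cQ nPQ.
(* An affine change of coordinates carries lines to lines; the slope and intercept are those of Y =
   (y - x) / 8 in terms of X = x / 4. *)
have s' : line_section minimal_frey ((l - 1) / 2%:R) (m / 8%:R)
            (to_minimal P) (to_minimal Q) (to_minimal T).
  case: P Q T s {cP cQ nPQ e} => x1 y1 [x2 y2] [x3 y3].
  rewrite /line_section /on_line /=; case=> -[-> -> ->] e1 e2 e3.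
  split; first by split; field.
  - transitivity ((x1 + x2 + x3) / 4%:R); first by field.
    by rewrite e1 /A /B; field.
  - transitivity ((x1 * x2 + x1 * x3 + x2 * x3) / 16%:R); first by field.
    by rewrite e2 /A /B; field.
  - transitivity ((x1 * x2 * x3) / 64%:R); first by field.
    by rewrite e3; field.
by rewrite e (padd_line_section minimal_smooth s') /pneg /= neg.
Qed.

Lemma on_curve_pmul P n :
  on_curve (legendre A B) P -> on_curve (legendre A B) (pmul (legendre A B) n
    P).
Proof. by move=> cP; elim: n => //= n IHn; apply: on_curve_padd. Qed.

Lemma to_minimalMn P n : on_curve (legendre A B) P ->
  omap to_minimal (pmul (legendre A B) n P) =
  pmul minimal_frey n (omap to_minimal P).
Proof.
move=> cP; elim: n => //= n IHn.
by rewrite to_minimalD ?on_curve_pmul // IHn.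
Qed.

End Transport.

Arguments minimal_frey {F} al be.
Arguments to_minimal {F} P.
Arguments of_minimal {F} P.

Lemma torsion_isog_minimal (G : zmodType) (al be : rat) :
  smooth (legendre (1 + 4%:R * al) (16%:R * be)) ->
  torsion_isog G (legendre (1 + 4%:R * al) (16%:R * be)) ->
  torsion_isog G (minimal_frey al be).
Proof.
move=> smAB [phi [injphi addphi imphi]].
have toK : cancel (omap (@to_minimal rat)) (omap of_minimal).
  by case=> [P|] //; apply: congr1 (to_minimalK P).
have ofK : cancel (omap (@of_minimal rat)) (omap to_minimal).
  by case=> [P|] //; apply: congr1 (of_minimalK P).
have cphi s : on_curve (legendre (1 + 4%:R * al) (16%:R * be)) (phi s).
  have [] // : torsion_points (legendre (1 + 4%:R * al) (16%:R * be)) (phi s).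
  by rewrite -imphi; exists s.
exists (omap to_minimal \o phi); split.
- by move=> s t /(can_inj toK)/injphi.
- by move=> s t; rewrite [LHS]/= addphi to_minimalD.
apply/seteqP; split=> [_ [s _ <-]|Q [cQ [n [n0 Qn0]]]] /=.
  have [_ [n [n0 sn0]]] : torsion_points (legendre (1 + 4%:R * al) (16%:R *
    be)) (phi s).
    by rewrite -imphi; exists s.
  split; first by rewrite on_curve_to_minimal.
  by exists n; split=> //; rewrite -to_minimalMn // sn0.
have cQ' : on_curve (legendre (1 + 4%:R * al) (16%:R * be)) (omap of_minimal Q).
  by rewrite -on_curve_to_minimal ofK.
have : torsion_points (legendre (1 + 4%:R * al) (16%:R * be)) (omap of_minimal
  Q).
  split=> //; exists n; split=> //; apply: (can_inj toK).
  by rewrite to_minimalMn // ofK Qn0.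
by rewrite -imphi => -[s _ es]; exists s => //=; rewrite es ofK.
Qed.


(* N = 2, 4: (0, 0) is divisible by 2 if A = a^2 and B = b^2, and by 4 if
   moreover a, b and a + b are squares, here of 1 - q^2, 2 q and 1 + q^2.
   N = 3: the point with abscissa q^2 is a flex. *)
Definition family_A (N : nat) (q : int) : int :=
  match N with
  | 3 => 1 + 2 * q
  | 4 => (1 - q ^+ 2) ^+ 4
  | _ => 1
  end.

Definition family_B (N : nat) (q : int) : int :=
  match N with
  | 1 => q
  | 2 => q ^+ 2
  | 3 => q ^+ 3 * (q + 2)
  | _ => 16 * q ^+ 4
  end.

Lemma family_point (N : nat) (q : int) (E : smooth_curve rat) :
  (1 <= N <= 4)%N ->
  forall defE : curve_of E = legendre (family_A N q)%:~R (family_B N q)%:~R,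
  exists P : curve_point E, P *+ N = origin defE /\ (N = 3%N -> P *+ 2 <> 0).
Proof.
case: N => [|[|[|[|[|]]]]] // _ defE.
- by exists (origin defE); rewrite mulr1n.
- have [|||P [e _]] := @halving _ _ _ defE 0 1 q%:~R (origin defE).
  + by rewrite /=; ring.
  + by rewrite /= rmorphXn /=; ring.
  + by congr (Some (_, _)); ring.
  by exists P.
- have [||R [R3 R0]] := @flex_point _ _ _ defE q%:~R.
  + by rewrite /= rmorphD rmorphM.
  + by rewrite /= rmorphM rmorphXn rmorphD.
  have O2 : origin defE *+ 2 = 0 by exact: (@two_torsion _ _ _ defE _ 0).
  (* A point of order 6, as the sum of points of orders 2 and 3. *)
  exists (origin defE + R); split=> [|_].
    by rewrite mulrnDl R3 addr0 mulrSr O2 add0r.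
  rewrite mulrnDl O2 add0r => R2; apply: R0.
  by rewrite -R3 mulrSr R2 add0r.
have eA : (family_A 4 q)%:~R = (1 - q%:~R ^+ 2) ^+ 4 :> rat.
  by rewrite /= rmorphXn rmorphB rmorphXn.
have eB : (family_B 4 q)%:~R = 16%:R * q%:~R ^+ 4 :> rat.
  by rewrite /= rmorphM rmorphXn.
set t : rat := q%:~R in eA eB.
have [|||P [e eP]] := @halving _ _ _ defE 0 ((1 - t ^+ 2) ^+ 2)
    ((2%:R * t) ^+ 2) (origin defE).
- by rewrite eA; ring.
- by rewrite eB; ring.
- by congr (Some (_, _)); ring.
have [|||Q [e' _]] := @halving _ _ _ defE ((1 - t ^+ 2) * (2%:R * t))
  ((1 - t ^+ 2) * (1 + t ^+ 2)) ((2%:R * t) * (1 + t ^+ 2)) P.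
- by rewrite eA; ring.
- by rewrite eB; ring.
- by rewrite eP; congr (Some (_, _)); ring.
by exists Q; rewrite (mulrnA Q 2 2) e' e.
Qed.

(* A prime of good reduction at which the family has exactly 4 N points. *)
Definition family_prime (N : nat) : nat := nth 0 [:: 0; 3; 5; 7; 13]%N N.

(* A and B modulo family_prime N *)
Definition family_residues (N : nat) : nat * nat :=
  nth (0, 0)%N [:: (0, 0); (1, 2); (1, 4); (2, 6); (9, 1)]%N N.

Lemma family_torsion (N : nat) (q : int) : (1 <= N <= 4)%N ->
  let: (A0, B0) := family_residues N in
  (family_prime N %| `|family_A N q - A0%:Z|)%N ->
  (family_prime N %| `|family_B N q - B0%:Z|)%N ->
  torsion_isog ('Z_2 * 'Z_(2 * N))%type
    (legendre (family_A N q)%:~R (family_B N q)%:~R).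
Proof.
move=> hN; case eAB : (family_residues N) => [A0 B0] hA hB.
have p_pr : prime (family_prime N) by case: N hN {hA hB eAB} => [|[|[|[|[|]]]]].
have p_odd : odd (family_prime N)
  by case: N hN {hA hB eAB p_pr} => [|[|[|[|[|]]]]].
set A := family_A N q in hA *; set B := family_B N q in hB *.
set p := family_prime N in hA hB p_pr p_odd.
(* Modulo p this product depends only on the residues, on which it is evaluated. *)
have p_good : ~~ (p %| `|(A * B * (A - B))%R|)%N.
  have /dvdzP[u eu] : (p %| A - A0%:Z)%Z by [].
  have /dvdzP[v ev] : (p %| B - B0%:Z)%Z by [].
  have -> : A * B * (A - B) = A0%:Z * B0%:Z * (A0%:Z - B0%:Z)
      + (u * B * (A - B) + A0%:Z * v * (A - B) + A0%:Z * B0%:Z * (u - v)) *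
          p%:Z.
    have -> : A = A0%:Z + u * p%:Z by rewrite -eu; ring.
    have -> : B = B0%:Z + v * p%:Z by rewrite -ev; ring.
    ring.
  rewrite -[(p %| _)%N]/(_ \in dvdz p) rpredDr; last first.
    exact: dvdz_mull (dvdzz _).
  by move: eAB; rewrite /p; case: (N) hN => [|[|[|[|[|]]]]] // _ [<- <-].
have A0' : A != 0.
  by apply: contraNneq p_good => ->; rewrite !mul0r dvdn0.
have B0' : B != 0 by apply: contraNneq p_good => ->; rewrite mulr0 mul0r dvdn0.
have AB' : A != B by apply: contraNneq p_good => ->; rewrite subrr mulr0 dvdn0.
have sm : smooth (legendre (A%:~R : rat) B%:~R).
  by apply: legendre_smooth; rewrite ?intr_eq0 ?eqr_int.
pose E := SmoothCurve sm; have defE : curve_of E = legendre A%:~R B%:~R by [].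
have [P [PN P3]] := family_point hN defE.
have O2 : origin defE *+ 2 = 0 by exact: (@two_torsion _ _ _ defE _ 0).
have T2 : opp_root defE *+ 2 = 0.
  exact: (@two_torsion _ _ _ defE _ (- A%:~R)).
have P2N : P *+ (2 * N) = 0 by rewrite mulnC mulrnA PN O2.
have N0 : (0 < N)%N by case/andP: hN.
apply: (@legendre_torsion p p_pr p_odd A B p_good E defE A0 B0 N (opp_root
  defE) P) => //.
- by move: (pintS_int p_pr 1 (A - A0%:Z)); rewrite expn1 hA rmorphB.
- by move: (pintS_int p_pr 1 (B - B0%:Z)); rewrite expn1 hB rmorphB.
- by move: eAB; rewrite /p; case: (N) hN => [|[|[|[|[|]]]]] // _ [<- <-];
    vm_compute.
- rewrite PN => /(congr1 (@pval _ _)) [] /eqP.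
  by rewrite eq_sym oppr_eq0 intr_eq0 (negPf A0').
- apply: order_2N => //; rewrite PN.
  by move/(congr1 (@pval _ _)).
Qed.

(** * Minimality and conductor of semistable Frey curves *)

Lemma wiso_invariants (F : fieldType) (W W' : wcurve F) : wiso W W' ->
  exists u : F, [/\ u != 0, u ^+ 4 * c4 W' = c4 W & u ^+ 12 * disc W' = disc W].
Proof.
case: W W' => A1 A2 A3 A4 A6 [A1' A2' A3' A4' A6'] [u [r [s [t]]]] /=.
case=> u0 [e1 e2 e3] e4 e6; exists u.
have -> : A1' = (A1 + 2%:R * s) / u by rewrite -e1; field.
have -> : A2' = (A2 - s * A1 + 3%:R * r - s ^+ 2) / u ^+ 2 by rewrite -e2;
  field.
have -> : A3' = (A3 + r * A1 + 2%:R * t) / u ^+ 3 by rewrite -e3; field.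
have -> : A4' = (A4 - s * A3 + 2%:R * r * A2 - (t + r * s) * A1
  + 3%:R * r ^+ 2 - 2%:R * s * t) / u ^+ 4 by rewrite -e4; field.
have -> : A6' = (A6 + r * A4 + r ^+ 2 * A2 + r ^+ 3 - t * A3 - t ^+ 2
  - r * t * A1) / u ^+ 6 by rewrite -e6; field.
split=> //; rewrite /c4 /disc /b2 /b4 /b6 /b8 /=; field; exact: u0.
Qed.

Lemma wiso_refl (F : fieldType) (W : wcurve F) : wiso W W.
Proof. by exists 1, 0, 0, 0; rewrite oner_neq0; split; [|split| |]; ring. Qed.

Lemma c4_map (R S : comNzRingType) (f : {rmorphism R -> S}) (W : wcurve R) :
  c4 (map_wcurve f W) = f (c4 W).
Proof.
by rewrite /c4 /b2 /b4 /= !(rmorph_nat, rmorphXn, rmorphB, rmorphM, rmorphD).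
Qed.

Lemma disc_map (R S : comNzRingType) (f : {rmorphism R -> S}) (W : wcurve R) :
  disc (map_wcurve f W) = f (disc W).
Proof.
rewrite /disc /b8 /b6 /b4 /b2 /=.
by rewrite !(rmorph_nat, rmorphXn, rmorphB, rmorphN, rmorphM, rmorphD).
Qed.

Lemma c4_base_change (R : comNzRingType) (W : wcurve int) :
  c4 (base_change R W) = (c4 W)%:~R.
Proof. exact: (c4_map (intmul 1)). Qed.

Lemma disc_base_change (R : comNzRingType) (W : wcurve int) :
  disc (base_change R W) = (disc W)%:~R.
Proof. exact: (disc_map (intmul 1)). Qed.

Section ClosedInvariants.
Variables (R : comNzRingType) (S : R -> Prop).
Hypotheses (S1 : S 1) (SB : forall x y, S x -> S y -> S (x - y))
  (SM : forall x y, S x -> S y -> S (x * y)).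

(** c4 is an integral polynomial in the coefficients; the subring [S] will be that of p-integral
    rationals. *)
Lemma closed_c4 (W : wcurve R) : S (a1 W) -> S (a2 W) -> S (a3 W) ->
  S (a4 W) -> S (a6 W) -> S (c4 W).
Proof.
have S0 : S 0 by rewrite -(subrr 1); apply: SB.
have SN x : S x -> S (- x) by move=> Sx; rewrite -[- x]add0r; apply: SB.
have SD x y : S x -> S y -> S (x + y).
  by move=> Sx Sy; rewrite -[y]opprK; apply: SB => //; apply: SN.
have Sn n : S n%:R.
  by elim: n => [//|n Sn]; rewrite -addn1 natrD; apply: SD.
move=> *; rewrite /c4 /b4 /b2 !expr2.
by do !first [assumption|exact: Sn|apply: SB|apply: SD|apply: SM].
Qed.

End ClosedInvariants.

(** If p divides the discriminant then c4 is a unit at p, so u^-4 = c4' / c4 is p-integral for any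
    p-integral model, hence so is 1 / u, and disc' = u^-12 disc is at least as divisible by p. *)
Lemma coprime_minimal (W : wcurve int) : disc W != 0 ->
  (forall p, prime p -> (p %| `|disc W|)%N -> ~~ (p %| `|c4 W|)%N) ->
  global_minimal_model (base_change rat W) W.
Proof.
move=> d0 cop; split=> [|p W' p_pr intW' isoW]; first exact: wiso_refl.
case: (boolP (p %| `|disc W|)%N) => [pd|npd]; last first.
  by rewrite lognE (negPf npd) !andbF.
have [u [u0 ec ed]] := wiso_invariants isoW.
rewrite c4_base_change disc_base_change in ec ed.
have Ic : pint p 0 (c4 W').
  apply: (@closed_c4 rat (fun x => pint p 0 x)) => [|x y|x y||||| ].
  - exact: (pint_nat p_pr 1).
  - exact: pintB.
  - exact: (@pintM _ p_pr 0 0).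
  - by move: intW'; rewrite /pint expr0 divr1 => /and5P[].
  - by move: intW'; rewrite /pint expr0 divr1 => /and5P[].
  - by move: intW'; rewrite /pint expr0 divr1 => /and5P[].
  - by move: intW'; rewrite /pint expr0 divr1 => /and5P[].
  - by move: intW'; rewrite /pint expr0 divr1 => /and5P[_ _ _ _ /andP[]].
have uc : ~~ pint p 1 (c4 W)%:~R by rewrite pintS_int // expn1 cop.
have Iu : pint p 0 u^-1.
  apply: (pint_of_pow p_pr (isT : (0 < 4)%N)).
  have c0 : (c4 W)%:~R != 0 :> rat by apply: contraNneq uc => ->; apply: pint0.
  have -> : u^-1 ^+ 4 = c4 W' * (c4 W)%:~R^-1.
    apply: (mulIf c0); rewrite divfK // -ec exprVn mulKf // expf_neq0 //.
  apply: pintMr => //; apply: pint_inv => //; exact: pint_int.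
have ed' : disc W' = u^-1 ^+ 12 * (disc W)%:~R.
  by rewrite -ed exprVn mulKf // expf_neq0.
apply: pint_logn => //.
  by rewrite ed' mulf_neq0 ?intr_eq0 // expf_neq0 // invr_eq0.
rewrite ed'; apply: pintM0; first by []; first exact: pint0X.
by rewrite pintS_int // pfactor_dvdnn.
Qed.

Section Frey.
Variables al be : int.

Definition frey : wcurve int :=
  WCurve 1 (al + 4%:R * be) 0 ((1 + 4%:R * al) * be) 0.

Let A := 1 + 4%:R * al.
Let B := 16%:R * be.

Lemma frey_c4 : c4 frey = A ^+ 2 - A * B + B ^+ 2.
Proof. by rewrite /c4 /b2 /b4 /A /B /=; ring. Qed.

Lemma frey_disc : disc frey = (be * (A * (A - B))) ^+ 2.
Proof. by rewrite /disc /b2 /b4 /b6 /b8 /A /B /=; ring. Qed.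

Hypothesis copAB : coprimez A B.

Lemma frey_prime p : prime p -> (p %| `|disc frey|)%N ->
  [\/ (p %| be)%Z, (p %| A)%Z | (p %| A - B)%Z].
Proof.
move=> p_pr; rewrite frey_disc abszX Euclid_dvdX // andbT !abszM !Euclid_dvdM
  //.
by case/or3P; [constructor 1|constructor 2|constructor 3].
Qed.

Lemma frey_coprime p : prime p -> (p %| A)%Z -> (p %| B)%Z -> False.
Proof.
move=> p_pr pA pB; have : (p %| gcdz A B)%Z by rewrite dvdz_gcd pA.
by rewrite (eqP copAB) dvdz1 absz_nat => /eqP p1; rewrite p1 in p_pr.
Qed.

(** Modulo a prime dividing B, A or A - B, the form A^2 - A B + B^2 becomes A^2, B^2 or B^2;
    divisibility by p would then pass to both A and B. *)
Lemma frey_c4_unit p : prime p -> (p %| `|disc frey|)%N ->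
  ~~ (p %| `|c4 frey|)%N.
Proof.
move=> p_pr /(frey_prime p_pr) dv; apply/negP.
rewrite -[(p %| _)%N]/(_ \in dvdz p) frey_c4 => pc.
have sq x : x ^+ 2 \in dvdz p -> (p %| x)%Z.
  by move=> h; have : (p %| `|(x ^+ 2)%R|)%N := h;
    rewrite abszX Euclid_dvdX // andbT.
case: dv => dv.
- have pB : (p %| B)%Z by apply: dvdz_mull.
  apply: (frey_coprime p_pr _ pB); apply: sq.
  have -> : A ^+ 2 = (A ^+ 2 - A * B + B ^+ 2) + (A - B) * B by ring.
  by rewrite rpredD ?dvdz_mull.
- apply: (frey_coprime p_pr dv); apply: sq.
  have -> : B ^+ 2 = (A ^+ 2 - A * B + B ^+ 2) + (B - A) * A by ring.
  by rewrite rpredD ?dvdz_mull.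
- have pB : (p %| B)%Z.
    apply: sq.
    have -> : B ^+ 2 = (A ^+ 2 - A * B + B ^+ 2) + (- A) * (A - B) by ring.
    by rewrite rpredD ?dvdz_mull.
  apply: (frey_coprime p_pr _ pB).
  by rewrite -[A](subrK B) rpredD.
Qed.

(** The Bezout relation is f'^2 - 4 f = a^2 + 4 c, valid in characteristic 2 as well. *)
Lemma separable_quadratic (F : fieldType) (a c : F) :
  a ^+ 2 + 4%:R * c != 0 -> separable_poly ('X^2 + a *: 'X - c%:P).
Proof.
move=> nz; rewrite separable_poly.unlock; apply/Bezout_eq1_coprimepP.
set d := a ^+ 2 + 4%:R * c in nz; set f := 'X^2 + _ - _.
have ef' : f^`() = 2%:R *: 'X + a%:P.
  by rewrite /f !derivE scaler_nat subr0 expr1 alg_polyC.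
exists ((- 4%:R / d)%:P, (d^-1)%:P * (2%:R *: 'X + a%:P)); rewrite /= ef' /f.
rewrite -!mul_polyC.
transitivity ((d^-1)%:P * (a ^+ 2 + 4%:R * c)%:P).
  by rewrite !(rmorphM, rmorphN, rmorphD, rmorphXn, rmorph_nat) /=; ring.
by rewrite -rmorphM /= mulVf.
Qed.

Lemma frey_multiplicative p : prime p -> (p %| `|disc frey|)%N ->
  multiplicative_reduction frey p.
Proof.
move=> p_pr /(frey_prime p_pr) dv.
have ch := pchar_Fp p_pr.
have dvE n : (n%:~R == 0 :> 'F_p) = (p %| n)%Z by rewrite (dvdz_pcharf ch).
have eA : (1 + 4%:R * al%:~R) = A%:~R :> 'F_p.
  by rewrite /A rmorphD rmorphM /= rmorph_nat.
have eB : 16%:R * be%:~R = B%:~R :> 'F_p by rewrite /B rmorphM rmorph_nat.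
have cop : A%:~R != 0 :> 'F_p \/ B%:~R != 0 :> 'F_p.
  case: (boolP (A%:~R == 0 :> 'F_p)) => hA; [right|by left].
  by apply/negP; rewrite dvE; apply: frey_coprime => //; rewrite -dvE.
have red : reduction frey p = WCurve 1 (al%:~R + 4%:R * be%:~R) 0
                                ((1 + 4%:R * al%:~R) * be%:~R) 0.
  by rewrite /reduction /base_change /map_wcurve /= !(rmorph_nat, rmorphM,
    rmorphD).
(* If p divides A or [be], the origin is singular; its tangent slopes have discriminant A + B,
   nonzero because exactly one of A and B vanishes modulo p. *)
have origin_node : (1 + 4%:R * al%:~R) * be%:~R = 0 :> 'F_p ->
    multiplicative_reduction frey p.
  move=> e; exists 0, 0; rewrite /node red /= e; split; try ring.
    by apply/eqP; ring.
  apply: separable_quadratic.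
  have -> : 1 ^+ 2 + 4%:R * (3%:R * 0 + (al%:~R + 4%:R * be%:~R)) =
            A%:~R + B%:~R :> 'F_p by rewrite -eA -eB; ring.
  move/eqP: e; rewrite eA mulf_eq0 => /orP[/eqP A0|/eqP b0].
    by rewrite A0 add0r; case: cop => //; rewrite A0 eqxx.
  have B0 : B%:~R = 0 :> 'F_p by rewrite -eB b0 mulr0.
  by rewrite B0 addr0; case: cop => //; rewrite B0 eqxx.
case: dv => dv.
- by apply: origin_node; move: dv; rewrite -dvE => /eqP->; rewrite mulr0.
- by apply: origin_node; rewrite eA; move: dv; rewrite -dvE => /eqP->;
    rewrite mul0r.
have AB : A%:~R = B%:~R :> 'F_p.
  by apply/subr0_eq/eqP; rewrite -rmorphB dvE.
have A0 : A%:~R != 0 :> 'F_p by case: cop => //; rewrite AB.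
(* In the remaining case p is odd: modulo 2 one has B = 0, hence A = 0. *)
have n2 : 2%:R != 0 :> 'F_p.
  apply: contraNneq A0 => e2; rewrite AB -eB.
  by have -> : 16%:R = 2%:R * 8%:R :> 'F_p by [ring]; rewrite e2 !mul0r.
have n4 : 4%:R != 0 :> 'F_p.
  by have -> : 4%:R = 2%:R * 2%:R :> 'F_p by [ring]; rewrite mulf_neq0.
have n8 : 8%:R != 0 :> 'F_p.
  by have -> : 8%:R = 2%:R * 4%:R :> 'F_p by [ring]; rewrite mulf_neq0.
(* The double root gives the singular point (-A, 0) of the Legendre form, which is (-A / 4, A / 8) =
   (-2 t, t) in minimal coordinates. The tangent slopes have discriminant -8 t = -A. *)
pose t : 'F_p := A%:~R / 8%:R.
have et : 8%:R * t = A%:~R by rewrite /t mulrC divfK.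
have e1 : 4%:R * al%:~R = 8%:R * t - 1 :> 'F_p by rewrite et -eA; ring.
have e2 : 2%:R * be%:~R = t :> 'F_p.
  by apply: (mulfI n8); rewrite et AB -eB; ring.
exists (- 2%:R * t), t; rewrite /node red /=; split.
- apply/eqP/(mulfI n4).
  transitivity (4%:R * (- t ^+ 2)); first by ring.
  transitivity (4%:R * (- 2%:R * t) ^+ 3 + (4%:R * al%:~R + 8%:R * (2%:R *
    be%:~R)) * (- 2%:R * t) ^+ 2
   + 2%:R * (1 + 4%:R * al%:~R) * (2%:R * be%:~R) * (- 2%:R * t)); last by ring.
  by rewrite e1 e2; ring.
- apply: (mulfI n2).
  transitivity (6%:R * (- 2%:R * t) ^+ 2 + (4%:R * al%:~R + 8%:R * (2%:R *
    be%:~R)) * (- 2%:R * t)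
   + (1 + 4%:R * al%:~R) * (2%:R * be%:~R)); last by ring.
  by rewrite e1 e2; ring.
- ring.
apply: separable_quadratic.
have -> : 1 ^+ 2 + 4%:R * (3%:R * (- 2%:R * t) + (al%:~R + 4%:R * be%:~R)) =
  1 + (- 24%:R * t) + 4%:R * al%:~R + 8%:R * (2%:R * be%:~R) :> 'F_p by ring.
rewrite e1 e2; have -> : 1 + (- 24%:R * t) + (8%:R * t - 1) + 8%:R * t =
  - (8%:R * t) by ring.
by rewrite oppr_eq0 et.
Qed.

Lemma frey_conductor_exponent p : prime p -> (p %| `|disc frey|)%N ->
  conductor_exponent frey p = 1%N.
Proof.
move=> p_pr pd; rewrite /conductor_exponent.
have -> : good_reduction frey p = false.
  rewrite /good_reduction /elliptic disc_base_change; apply/negbTE.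
  by rewrite negbK -(dvdz_pcharf (pchar_Fp p_pr)).
by rewrite (asboolT (frey_multiplicative p_pr pd)).
Qed.

Lemma prod_primes_dvd (s : seq nat) R : uniq s -> all prime s ->
  (forall p, p \in s -> (p %| R)%N) -> (\prod_(p <- s) p %| R)%N.
Proof.
elim: s => [|p s IHs] /=; first by rewrite big_nil dvd1n.
case/andP=> nps us /andP[p_pr s_pr] dv; rewrite big_cons Gauss_dvd.
  rewrite dv ?mem_head // IHs // => r rs; apply: dv.
  by rewrite inE rs orbT.
rewrite big_seq; apply: (big_ind (coprime p)) => [|x y px py|r rs].
- exact: coprimen1.
- by rewrite coprimeMr px.
rewrite prime_coprime //.
rewrite dvdn_prime2 //; last exact: (allP s_pr).
by apply: contraNneq nps => ->.
Qed.

Lemma frey_conductor_dvd R :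
  (forall p, prime p -> (p %| `|disc frey|)%N -> (p %| R)%N) ->
  (conductor frey %| R)%N.
Proof.
move=> dv; rewrite /conductor.
have -> : \prod_(p <- primes `|disc frey|) (p ^ conductor_exponent frey p)%N =
          (\prod_(p <- primes `|disc frey|) p)%N.
  apply: eq_big_seq => p; rewrite mem_primes => /and3P[p_pr _ pd].
  by rewrite frey_conductor_exponent.
apply: prod_primes_dvd; rewrite ?primes_uniq //.
  by apply/allP => p; rewrite mem_primes => /andP[].
by move=> p; rewrite mem_primes => /and3P[p_pr _ pd]; apply: dv.
Qed.

(** As c4 is positive, cubing conductor^2 < c4 gives the required inequality. *)
Lemma frey_good R : disc frey != 0 -> (0 < R)%N ->
  (forall p, prime p -> (p %| `|disc frey|)%N -> (p %| R)%N) ->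
  R%:Z ^+ 2 < c4 frey -> good_curve (base_change rat frey).
Proof.
move=> d0 R0 dv Rc; exists frey; split.
  by apply: coprime_minimal => // p; apply: frey_c4_unit.
have cR : (conductor frey <= R)%N by apply: dvdn_leq => //;
  apply: frey_conductor_dvd.
have c0 : 0 <= c4 frey by apply: ltW; apply: le_lt_trans Rc; rewrite sqr_ge0.
apply: (@lt_le_trans _ _ (`|c4 frey ^+ 3|)); last by rewrite le_max lexx.
rewrite ger0_norm ?exprn_ge0 // (exprM _ 2 3) ltrXn2r //.
apply: le_lt_trans Rc; rewrite lerXn2r // ?nnegrE //.
Qed.

End Frey.

(** * The parameter q and the four families *)

Definition base (k : nat) : nat := (32 ^ (31 ^ k.+1))%N.

Lemma baseS k : base k.+1 = (base k ^ 31)%N.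
Proof. by rewrite /base [X in (32 ^ X)%N]expnSr expnM. Qed.

Lemma base_gt k : (31 < base k)%N.
Proof. by rewrite -[32%N]expn1 leq_exp2l // expn_gt0. Qed.

Lemma base_mono m n : (m < n)%N -> (base m ^ 31 <= base n)%N.
Proof. by move=> mn; rewrite -baseS leq_exp2l // leq_exp2l. Qed.

Definition base16 (k : nat) : nat := (2 * 32 ^ (31 ^ k.+1).-1)%N.

Lemma baseE k : base k = (16 * base16 k)%N.
Proof. by rewrite mulnA -expnS prednK // expn_gt0. Qed.

Lemma base_prime k p : prime p -> (p %| base k)%N -> p = 2%N.
Proof.
move=> p_pr; rewrite Euclid_dvdX // => /andP[+ _].
by rewrite -[32%N]/(2 ^ 5)%N Euclid_dvdX // => /andP[+ _];
  rewrite dvdn_prime2 // => /eqP.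
Qed.

(** Modulo 5 and 13 only the square is independent of k: q alternates between two opposite residues.
    The families N = 2 and N = 4, tested at these primes, involve only q^2. *)
Lemma base_mod k : [/\ (base k)%:R = 2%:R :> 'F_3,
  (base k)%:R ^+ 2 = - 1 :> 'F_5, (base k)%:R = 4%:R :> 'F_7 &
  (base k)%:R ^+ 2 = 10%:R :> 'F_13].
Proof.
elim: k => [|k [e3 e5 e7 e13]].
  have -> : base 0 = (32 ^ 31)%N by [].
  by split; rewrite natrX; apply/val_inj; vm_compute.
rewrite baseS; split; rewrite natrX ?e3 ?e7 1?exprAC ?e5 ?e13;
  by apply/val_inj; vm_compute.
Qed.

(** In x^l - 1 = (x - 1)(1 + x + ... + x^(l - 1)) the second factor has l terms, each 1 modulo l. *)
Lemma dvdn_pred_exp l x m : (l ^ m.+1 %| x.-1)%N -> (l ^ m.+2 %| (x ^ l).-1)%N.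
Proof.
case: x => [|x]; first by case: l => // l _; rewrite exp0n.
move=> /= dx; rewrite predn_exp expnSr dvdn_mul //.
rewrite /dvdn -modn_summ.
rewrite (eq_bigr (fun=> 1 %% l)%N) => [|i _]; last first.
  rewrite -modnXm -addn1 -modnDml; have /eqP -> : (l %| x)%N.
    by apply: dvdn_trans dx; rewrite dvdn_exp.
  by rewrite add0n modnXm exp1n.
by rewrite modn_summ sum_nat_const card_ord muln1 modnn.
Qed.

Lemma dvdn_pred_base k : (31 ^ k.+2 %| (base k).-1)%N.
Proof.
elim: k => [|k IHk]; last by rewrite baseS; apply: dvdn_pred_exp.
by apply: (@dvdn_pred_exp 31 32 0).
Qed.

Lemma base_radical k : exists d : nat, [/\ (0 < d)%N,
  (31 * d <= (base k).-1)%N &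
  forall p, prime p -> (p %| (base k).-1)%N -> (p %| d)%N].
Proof.
(* One factor 31 is kept, so that d still has every prime divisor of q - 1. *)
have /dvdnP[c ec] := dvdn_pred_base k; exists (c * 31)%N.
have b0 : (0 < (base k).-1)%N by move: (base_gt k); case: (base k) => [|[]].
have c0 : (0 < c)%N by move: b0; rewrite ec; case: (c).
split; first by rewrite muln_gt0 c0.
- by rewrite ec mulnCA leq_pmul2l // mulnn leq_exp2l.
- move=> p p_pr; rewrite ec Euclid_dvdM // => dv; rewrite Euclid_dvdM //.
  case/orP: dv => [-> //|]; rewrite Euclid_dvdX // => /andP[-> _].
  by rewrite orbT.
Qed.

(** The solution of A = 1 + 4 [al] at q = 16 h, written without division by unfolding one factor q
    where needed. *)
Definition family_al (N : nat) (h : int) : int :=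
  let q := 16 * h in
  match N with
  | 3 => 8 * h
  | 4 => - q ^+ 2 + 24 * h * q ^+ 3 - q ^+ 6 + 4 * h * q ^+ 7
  | _ => 0
  end.

Definition family_be (N : nat) (h : int) : int :=
  let q := 16 * h in
  match N with
  | 1 => h
  | 2 => 16 * h ^+ 2
  | 3 => h * q ^+ 2 * (q + 2)
  | _ => q ^+ 4
  end.

Lemma family_alE N h : 1 + 4 * family_al N h = family_A N (16 * h).
Proof. by case: N => [|[|[|[|[|N]]]]]; rewrite /=; ring. Qed.

Lemma family_beE N h : 16 * family_be N h = family_B N (16 * h).
Proof. by case: N => [|[|[|[|[|N]]]]]; rewrite /=; ring. Qed.

(** The product of the distinct factors of A B (A - B), with q replaced by 2 and q - 1 by d. *)
Definition family_radical (N : nat) (q d : int) : int :=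
  match N with
  | 1 => 2 * d
  | 2 => 2 * d * (q + 1)
  | 3 => 2 * d * (q + 1) * (1 + 2 * q) * (q + 2)
  | _ => 2 * d * (q + 1) * (q ^+ 2 + 1) * ((q ^+ 2 - 1) ^+ 2 - 4 * q ^+ 2)
  end.

Lemma Euclid_dvdzM p (m n : int) : prime p ->
  (p %| m * n)%Z = (p %| m)%Z || (p %| n)%Z.
Proof. by move=> p_pr; rewrite !dvdzE abszM Euclid_dvdM. Qed.

Lemma family_radicalP (N : nat) (q d : int) p : (1 <= N <= 4)%N -> prime p ->
  ((p %| q)%Z -> p = 2%N) -> ((p %| q - 1)%Z -> (p %| d)%Z) ->
  (p %| family_A N q * family_B N q * (family_A N q - family_B N q))%Z ->
  (p %| family_radical N q d)%Z.
Proof.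
move=> hN p_pr pq pd.
have {}pq : (p %| q)%Z -> (p %| 2)%Z by move/pq->.
have p1 : (p %| 1)%Z = false.
  by apply/negbTE; rewrite dvdzE dvdn1 neq_ltn prime_gt1 ?orbT.
have pN x : (p %| - x)%Z = (p %| x)%Z by rewrite !dvdzE abszN.
have dvM m n := @Euclid_dvdzM p m n p_pr.
have dvX (m : int) n : (p %| m ^+ n.+1)%Z = (p %| m)%Z.
  by rewrite !dvdzE abszX Euclid_dvdX // andbT.
pose dvE := (dvX, dvM).
case: N hN => [|[|[|[|[|]]]]] // _ /=.
- have -> : 1 * q * (1 - q) = - (q * (q - 1)) by ring.
  by rewrite pN !dvE => /orP[/pq ->|/pd ->]; rewrite ?orbT.
- have -> : 1 * q ^+ 2 * (1 - q ^+ 2) = - (q ^+ 2 * ((q - 1) * (q + 1)))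
    by ring.
  by rewrite pN !dvE => /or3P[/pq ->|/pd ->|->]; rewrite ?orbT.
- have -> : (1 + 2 * q) * (q ^+ 3 * (q + 2)) * (1 + 2 * q - q ^+ 3 * (q + 2))
    = - ((1 + 2 * q) * (q ^+ 3 * (q + 2)) * ((q - 1) * (q + 1) ^+ 3)) by ring.
  rewrite pN !dvE.
  by case/orP=> [/or3P[->|/pq ->|->]|/orP[/pd ->|->]]; rewrite ?orbT.
have -> : (1 - q ^+ 2) ^+ 4 * (16 * q ^+ 4) * ((1 - q ^+ 2) ^+ 4 - 16 * q ^+ 4)
   = ((q - 1) ^+ 4 * (q + 1) ^+ 4) * (2 ^+ 4 * q ^+ 4)
     * (((q ^+ 2 - 1) ^+ 2 - 4 * q ^+ 2) * (q ^+ 2 + 1) ^+ 2) by ring.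
rewrite !dvE.
by case/orP=> [/orP[/orP[/pd ->|->]|/orP[->|/pq ->]]|/orP[->|->]];
  rewrite ?orbT.
Qed.

Lemma family_coprime (N : nat) (q h m : int) : (1 <= N <= 4)%N ->
  q = 16 * h -> q = 3 * m + 2 -> coprimez (family_A N q) (family_B N q).
Proof.
move=> hN eh em.
case: N hN => [|[|[|[|[|]]]]] // _ /=;
  rewrite /coprimez ?gcd1z // -/(coprimez _ _).
  (* A common prime of 1 + 2 q and q + 2 divides 2 (q + 2) - (1 + 2 q) = 3, which q = 2 mod 3
     excludes. *)
  rewrite coprimezMr coprimezXr ?andTb; apply/coprimezP.
    by exists (m + 1, 1 - 2 * (m + 1)); rewrite /= em; ring.
  by exists (1, - 2); rewrite /=; ring.
rewrite coprimezMr; apply/andP; split; rewrite coprimezXl //.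
  by apply/coprimezP; exists (1, 16 * h ^+ 2); rewrite /= eh; ring.
by rewrite coprimezXr //; apply/coprimezP; exists (1, q); rewrite /=; ring.
Qed.

(* As (12 / 31)^2 < 3 / 4, this makes R^2 smaller than 3 M^2 / 4 <= c4. *)
Lemma family_bound (N : nat) (q d : int) : (1 <= N <= 4)%N ->
  32 <= q -> 0 < d -> 31 * d <= q - 1 ->
  exists M : int, [/\ M = family_A N q \/ M = family_B N q, q <= M,
    0 < family_radical N q d & 31 * family_radical N q d <= 12 * M].
Proof.
move=> hN q32 d0 hd; have q0 : 0 < q by lia.
case: N hN => [|[|[|[|[|]]]]] // _ /=.
- by exists q; split; [right| lia | lia | lia].
- exists (q ^+ 2); split; [by right|nia| |].
    by rewrite !mulr_gt0 //; lia.
  have -> : 31 * (2 * d * (q + 1)) = (31 * d) * (2 * (q + 1)) by ring.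
  apply: (@le_trans _ _ ((q - 1) * (2 * (q + 1)))); last by nia.
  by rewrite ler_pM2r //; lia.
- exists (q ^+ 3 * (q + 2)); split; [by right|by rewrite !exprS; nia| |].
    by rewrite !mulr_gt0 //; lia.
  have -> : 31 * (2 * d * (q + 1) * (1 + 2 * q) * (q + 2)) =
    (31 * d) * (2 * (q + 1) * (1 + 2 * q) * (q + 2)) by ring.
  apply: (@le_trans _ _ ((q - 1) * (2 * (q + 1) * (1 + 2 * q) * (q + 2)))).
    by rewrite ler_pM2r // !mulr_gt0 //; lia.
  have -> : (q - 1) * (2 * (q + 1) * (1 + 2 * q) * (q + 2)) =
    (2 * (q ^+ 2 - 1) * (1 + 2 * q)) * (q + 2) by ring.
  rewrite mulrA ler_pM2r; last by lia.
  have -> : 12 * q ^+ 3 = (2 * q ^+ 2) * (6 * q) by ring.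
  apply: ler_pM; rewrite ?mulr_ge0 //; nia.
(* After 31 d is bounded by q - 1, the claim reads s * 2 (s + 2) * (s^2 - 4 q^2) <= s * 12 s *
   s^2. *)
pose s := q ^+ 2 - 1.
have s0 : 0 < s by rewrite /s; nia.
have qs : q ^+ 2 = s + 1 by rewrite /s; ring.
have t0 : 0 < s ^+ 2 - 4 * q ^+ 2.
  by rewrite qs; have : 1023 <= s by [rewrite /s; nia]; nia.
exists ((1 - q ^+ 2) ^+ 4); split; [by left| | |].
- have -> : (1 - q ^+ 2) ^+ 4 = (s * s) * (s * s) by rewrite /s; ring.
  have qs' : q <= s by rewrite /s; nia.
  have ss : s <= s * s by nia.
  by nia.
- by rewrite -/s !mulr_gt0 //; lia.
rewrite -/s; have -> : 31 * (2 * d * (q + 1) * (q ^+ 2 + 1) * (s ^+ 2 - 4 * q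
  ^+ 2)) =
   (31 * d) * (q + 1) * (2 * (q ^+ 2 + 1)) * (s ^+ 2 - 4 * q ^+ 2) by ring.
apply: (@le_trans _ _ ((q - 1) * (q + 1) * (2 * (q ^+ 2 + 1)) * (s ^+ 2 - 4 *
  q ^+ 2))).
  by rewrite !ler_pM2r //; lia.
have -> : (q - 1) * (q + 1) = s by rewrite /s; ring.
have -> : 12 * (1 - q ^+ 2) ^+ 4 = s * (12 * s) * s ^+ 2 by rewrite /s; ring.
apply: ler_pM; [by rewrite !mulr_ge0 //; lia|exact: ltW| |].
  by rewrite ler_pM2l // qs; lia.
by rewrite gerBl mulr_ge0 // sqr_ge0.
Qed.

Lemma norm_form_sqr (A B M : int) : M = A \/ M = B ->
  3 * M ^+ 2 <= 4 * (A ^+ 2 - A * B + B ^+ 2).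
Proof.
case=> ->; rewrite -subr_ge0.
  have -> : 4 * (A ^+ 2 - A * B + B ^+ 2) - 3 * A ^+ 2 = (A - 2 * B) ^+ 2
    by ring.
  exact: sqr_ge0.
have -> : 4 * (A ^+ 2 - A * B + B ^+ 2) - 3 * B ^+ 2 = (2 * A - B) ^+ 2 by ring.
exact: sqr_ge0.
Qed.

Lemma norm_form_lower (A B M R : int) : M = A \/ M = B ->
  0 < R -> 31 * R <= 12 * M -> R ^+ 2 < A ^+ 2 - A * B + B ^+ 2.
Proof.
move=> /norm_form_sqr M4 R0 RM.
have MR : (31 * R) ^+ 2 <= (12 * M) ^+ 2 by rewrite lerXn2r // nnegrE; lia.
have R2 : 0 < R ^+ 2 by rewrite exprn_gt0.
by move: MR; rewrite !exprMn; lia.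
Qed.

Lemma family_AB_bound (N : nat) (q : int) : (1 <= N <= 4)%N -> 32 <= q ->
  [/\ 0 < family_A N q <= q ^+ 8 & 0 < family_B N q <= q ^+ 8].
Proof.
move=> hN q32; have q0 : 0 < q by lia.
have qX n m : (n <= m)%N -> q ^+ n <= q ^+ m.
  by move=> nm; apply: ler_weXn2l => //; lia.
case: N hN => [|[|[|[|[|]]]]] // _ /=; split.
- by rewrite -(expr0 q) qX.
- by rewrite q0 -{1}(expr1 q) qX.
- by rewrite -(expr0 q) qX.
- by rewrite exprn_gt0 // qX.
- apply/andP; split; first by lia.
  by apply: le_trans (qX 2%N 8%N isT); nia.
- rewrite mulr_gt0 ?exprn_gt0 //=; last by lia.
  apply: le_trans (qX 5%N 8%N isT); rewrite -[5%N]/(3 + 2)%N exprD.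
  by rewrite ler_pM2l ?exprn_gt0 //; nia.
- have -> : (1 - q ^+ 2) ^+ 4 = (q ^+ 2 - 1) ^+ 4 by ring.
  have s0 : 0 < q ^+ 2 - 1 by nia.
  rewrite exprn_gt0 //=.
  have -> : q ^+ 8 = (q ^+ 2) ^+ 4 by rewrite -exprM.
  by rewrite lerXn2r ?nnegrE //; [exact: ltW|exact: sqr_ge0|lia].
rewrite mulr_gt0 ?exprn_gt0 //=.
apply: le_trans (qX 5%N 8%N isT); rewrite [q ^+ 5]exprS.
by rewrite ler_pM2r ?exprn_gt0 //; lia.
Qed.

Lemma norm_form_upper (A B q : int) : 32 <= q ->
  0 < A <= q ^+ 8 -> 0 < B <= q ^+ 8 -> A ^+ 2 - A * B + B ^+ 2 < q ^+ 31.
Proof.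
move=> q32 /andP[A0 Aq] /andP[B0 Bq]; have q0 : 0 < q by lia.
have A2 : A ^+ 2 <= q ^+ 16.
  by rewrite -[16%N]/(8 * 2)%N exprM lerXn2r // nnegrE ltW // exprn_gt0.
have B2 : B ^+ 2 <= q ^+ 16.
  by rewrite -[16%N]/(8 * 2)%N exprM lerXn2r // nnegrE ltW // exprn_gt0.
have AB0 : 0 < A * B by rewrite mulr_gt0.
have Q0 : 0 < q ^+ 16 by rewrite exprn_gt0.
apply: (@lt_le_trans _ _ (q ^+ 17)); first by rewrite exprS; nia.
by apply: ler_weXn2l => //; lia.
Qed.

Lemma coprime_of_primes (m n : nat) : (0 < n)%N ->
  (forall p, prime p -> (p %| n)%N -> ~~ (p %| m)%N) -> coprime m n.
Proof.
move=> n0 h; rewrite /coprime eqn_leq gcdn_gt0 n0 orbT andbT leqNgt.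
apply/negP => g1; have p_pr := pdiv_prime g1; have := pdiv_dvd (gcdn m n).
by rewrite dvdn_gcd => /andP[pm pn]; move: (h _ p_pr pn); rewrite pm.
Qed.

Lemma cube_fraction_inj (x d y e : int) :
  coprime `|x| `|d| -> coprime `|y| `|e| -> 0 < x -> 0 < y ->
  x ^+ 3 * e = y ^+ 3 * d -> x = y.
Proof.
move=> cop cop' x0 y0 /(congr1 absz); rewrite [LHS]abszM [RHS]abszM !abszX => h.
have dv1 : (`|x| ^ 3 %| `|y| ^ 3)%N.
  by rewrite -(@Gauss_dvdl _ _ `|d|) ?coprimeXl // -h dvdn_mulr.
have dv2 : (`|y| ^ 3 %| `|x| ^ 3)%N.
  by rewrite -(@Gauss_dvdl _ _ `|e|) ?coprimeXl // h dvdn_mulr.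
have /eqP : (`|x| ^ 3 = `|y| ^ 3)%N by apply/eqP; rewrite eqn_dvd dv1.
rewrite eqn_exp2r // => /eqP ee.
by rewrite -(gtz0_abs x0) -(gtz0_abs y0) ee.
Qed.

(* The pair (c4^3, disc) is j in lowest terms. *)
Lemma wiso_c4_eq (W W' : wcurve int) :
  coprime `|c4 W| `|disc W| -> coprime `|c4 W'| `|disc W'| ->
  0 < c4 W -> 0 < c4 W' ->
  wiso (base_change rat W) (base_change rat W') -> c4 W = c4 W'.
Proof.
move=> cop cop' c0 c0' /wiso_invariants[u [u0]].
rewrite !c4_base_change !disc_base_change => ec ed.
apply: (cube_fraction_inj cop cop' c0 c0').
move: (c4 W) (c4 W') (disc W) (disc W') ec ed => x y d e ec ed.
have cube (z : int) : (z ^+ 3)%:~R = z%:~R ^+ 3 :> rat by rewrite rmorphXn.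
apply: (@intr_inj rat); rewrite [LHS]intrM [RHS]intrM !cube -ec -ed.
ring.
Qed.

Lemma natr_dvdz (p : nat) (n : int) : prime p ->
  n%:~R = 0 :> 'F_p -> (p %| `|n|)%N.
Proof.
move=> p_pr e; rewrite -[(p %| _)%N]/(p %| n)%Z.
by rewrite (dvdz_pcharf (pchar_Fp p_pr)) e.
Qed.

(** * The families evaluated at the parameters [base k] *)

Section Family.
Variables (N : nat) (hN : (1 <= N <= 4)%N).

Let q (k : nat) : int := (base k)%:Z.
Let al k := family_al N (base16 k).
Let be k := family_be N (base16 k).

Lemma base_eq k : q k = 16 * (base16 k)%:Z.
Proof. by rewrite /q baseE PoszM. Qed.

Lemma base_ge32 k : 32 <= q k.
Proof. by rewrite /q lez_nat base_gt. Qed.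

Lemma family_A_al k : 1 + 4 * al k = family_A N (q k).
Proof. by rewrite base_eq -family_alE. Qed.

Lemma family_B_be k : 16 * be k = family_B N (q k).
Proof. by rewrite base_eq -family_beE. Qed.

Lemma family_coprime_base k : coprimez (1 + 4 * al k) (16 * be k).
Proof.
rewrite family_A_al family_B_be.
have [e3 _ _ _] := base_mod k.
have /dvdzP[m em] : (3 %| q k - 2)%Z.
  by apply: (@natr_dvdz 3) => //; rewrite rmorphB /= [(q k)%:~R]e3 subrr.
apply: (family_coprime hN (base_eq k) (m := m)).
by rewrite [3 * m]mulrC -em; ring.
Qed.

Lemma family_nonzero k :
  [/\ family_A N (q k) != 0, family_B N (q k) != 0 & family_A N (q k) !=
    family_B N (q k)].
Proof.
have [/andP[A0 _] /andP[B0 _]] := family_AB_bound hN (base_ge32 k).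
split; [by rewrite gt_eqF|by rewrite gt_eqF|];
  rewrite -family_A_al -family_B_be.
(* [A] is odd and [B] is even. *)
by apply/eqP; lia.
Qed.

Definition family_model k : wcurve int := frey (al k) (be k).

Lemma family_c4 k : c4 (family_model k) =
  family_A N (q k) ^+ 2 - family_A N (q k) * family_B N (q k) + family_B N (q
    k) ^+ 2.
Proof. by rewrite frey_c4 family_A_al family_B_be. Qed.

Lemma family_disc_neq0 k : disc (family_model k) != 0.
Proof.
rewrite frey_disc family_A_al family_B_be; have [A0 B0 AB] := family_nonzero k.
rewrite expf_neq0 // !mulf_neq0 ?subr_eq0 //.
by apply: contraNneq B0 => be0; rewrite -family_B_be be0 mulr0.
Qed.

Lemma family_model_coprime k :
  coprime `|c4 (family_model k)| `|disc (family_model k)|.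
Proof.
apply: coprime_of_primes; first by rewrite absz_gt0 family_disc_neq0.
by move=> p p_pr; apply: frey_c4_unit => //; apply: family_coprime_base.
Qed.

Lemma family_good k : good_curve (base_change rat (family_model k)).
Proof.
have [d [d0 hd pd]] := base_radical k.
have eq1 : q k - 1 = (base k).-1%:Z.
  by rewrite -subn1 -subzn // (leq_trans _ (base_gt k)).
have d31 : 31 * d%:Z <= q k - 1 by rewrite eq1 -PoszM lez_nat.
have dz : 0 < d%:Z by [].
have [M [eM _ R0 RM]] := family_bound hN (base_ge32 k) dz d31.
set R := family_radical N (q k) d in R0 RM.
have eR : `|R|%N%:Z = R by rewrite gtz0_abs.
apply: (@frey_good _ _ (family_coprime_base k) `|R|%N).
- exact: family_disc_neq0.
- by rewrite absz_gt0 gt_eqF.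
- move=> p p_pr dv; apply: (family_radicalP hN p_pr).
  + by move=> pq; apply: (@base_prime k).
  + by rewrite eq1; apply: pd.
  rewrite -family_A_al -family_B_be; move: dv.
  move/(frey_prime p_pr); case=> h.
  + by apply: dvdz_mulr; apply: dvdz_mull; apply: dvdz_mull.
  + by apply: dvdz_mulr; apply: dvdz_mulr.
  + exact: dvdz_mull.
- by rewrite eR family_c4; apply: norm_form_lower eM R0 RM.
Qed.

(** The upper bound is the parameter at k + 1, so the intervals for different k are disjoint and c4
    determines k. *)
Lemma family_c4_bounds k : q k <= c4 (family_model k) < q k ^+ 31.
Proof.
have q32 := base_ge32 k.
have [hA hB] := family_AB_bound hN q32;
  rewrite family_c4 norm_form_upper // andbT.
(* Only [q k <= M] is wanted here, so d = 1 will do. *)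
have [|M [eM qM _ _]] := family_bound hN q32 (isT : 0 < 1 :> int); first by lia.
by move/norm_form_sqr: eM; nia.
Qed.

Lemma family_wiso_inj m n :
  wiso (base_change rat (family_model m)) (base_change rat (family_model n)) ->
  m = n.
Proof.
have c0 k : 0 < c4 (family_model k).
  by have /andP[h _] := family_c4_bounds k; apply: lt_le_trans h;
    have := base_ge32 k; lia.
move=> iso; have e := wiso_c4_eq (family_model_coprime m)
  (family_model_coprime n)
  (c0 m) (c0 n) iso.
have lt_neq i j : (i < j)%N -> c4 (family_model i) <> c4 (family_model j).
  move=> ij eij; have /andP[_ hi] := family_c4_bounds i.
  have /andP[hj _] := family_c4_bounds j.
  have : q i ^+ 31 <= q j.
    by rewrite /q -(rmorphXn Posz) lez_nat base_mono.
  by rewrite leNgt (le_lt_trans hj) // -eij.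
case: (ltngtP m n) => // [/lt_neq//|/lt_neq]; by rewrite e.
Qed.

Lemma family_residuesP k :
  (family_prime N %| `|family_A N (q k) - (family_residues N).1%:Z|)%N /\
  (family_prime N %| `|family_B N (q k) - (family_residues N).2%:Z|)%N.
Proof.
have [e3 e5 e7 e13] := base_mod k.
have qE p : (q k)%:~R = (base k)%:R :> 'F_p by [].
case: N hN => [|[|[|[|[|]]]]] // _; split;
  rewrite /family_prime /family_residues.
- by [].
- by apply: natr_dvdz; rewrite // rmorphB /= qE e3 subrr.
- by [].
- apply: natr_dvdz; rewrite // rmorphB /= (rmorphXn (intmul 1)) /= qE e5.
  by apply/val_inj; vm_compute.
- apply: natr_dvdz; rewrite // rmorphB /= rmorphD rmorphM /= qE e7.
  by apply/val_inj; vm_compute.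
- apply: natr_dvdz; rewrite // rmorphB /= rmorphM rmorphXn rmorphD /= qE e7.
  by apply/val_inj; vm_compute.
- apply: natr_dvdz; rewrite // rmorphB /= rmorphXn rmorphB rmorphXn /= qE e13.
  by apply/val_inj; vm_compute.
- have -> : family_B 4 (q k) = 16 * (q k ^+ 2) ^+ 2 by rewrite /=; ring.
  apply: natr_dvdz; rewrite // rmorphB /= rmorphM !rmorphXn /= qE e13.
  by apply/val_inj; vm_compute.
Qed.

Lemma family_torsion_isog k :
  torsion_isog ('Z_2 * 'Z_(2 * N))%type (base_change rat (family_model k)).
Proof.
have -> : base_change rat (family_model k) = minimal_frey (al k)%:~R (be k)%:~R.
  rewrite /base_change /map_wcurve /minimal_frey /=.
  by rewrite !(rmorph_nat, rmorphM, rmorphD).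
have eA : 1 + 4%:R * (al k)%:~R = (family_A N (q k))%:~R :> rat.
  by rewrite -family_A_al rmorphD rmorphM.
have eB : 16%:R * (be k)%:~R = (family_B N (q k))%:~R :> rat.
  by rewrite -family_B_be rmorphM.
have [A0 B0 AB] := family_nonzero k.
apply: torsion_isog_minimal; rewrite eA eB.
  by apply: legendre_smooth; rewrite ?intr_eq0 ?eqr_int.
have [hA hB] := family_residuesP k.
have := family_torsion (q k) hN;
  case: (family_residues N) hA hB => A0' B0' hA hB.
exact.
Qed.

End Family.

Theorem theorem1 (N : nat) (hN : (1 <= N <= 4)%N) :
  exists E : nat -> wcurve rat,
    (forall n : nat,
       [/\ elliptic (E n),
           good_curve (E n)
         & torsion_isog ('Z_2 * 'Z_(2 * N))%type (E n)]) /\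
    (forall m n : nat, wiso (E m) (E n) -> m = n).
Proof.
exists (fun k => base_change rat (family_model N k)); split=> [k|m n];
  last first.
  exact: family_wiso_inj.
split; [|exact: family_good|exact: family_torsion_isog].
by rewrite /elliptic disc_base_change intr_eq0 family_disc_neq0.
Qed.
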